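(* Let $S$ be a codimension one Lie subgroup of the nilpotent Iwasawa group $N$ of an irreducible symmetric space of non-compact type. Then the foliation of $N$ by left cosets of $S$ is a homogeneous foliation by mutually congruent minimal hypersurfaces. In particular, if moreover $S$ is a Ricci soliton with the induced metric, then $S$ induces a foliation of $N$ by mutually congruent Ricci soliton minimal hypersurfaces of $N$.
   Context: For an irreducible Riemannian symmetric space of non-compact type $M=G/K$ ($G$ the identity component of the isometry group), let $\mathfrak g=\mathfrak k\oplus\mathfrak p$ be a Cartan decomposition with Cartan involution $\theta$, $B$ the Killing form, $\langle X,Y\rangle_{B_\theta}=-B(X,\theta Y)$, $\mathfrak a\subset\mathfrak p$ maximal abelian, $\mathfrak g=\mathfrak g_0\oplus\bigoplus_{\lambda\in\Sigma}\mathfrak g_\lambda$ the restricted root space decomposition, $\Sigma^+$ a set of positive roots and $\mathfrak n=\bigoplus_{\lambda\in\Sigma^+}\mathfrak g_\lambda$. $A,N,AN$ are the connected subgroups of $G$ with Lie algebras $\mathfrak a,\mathfrak n,\mathfrak a\oplus\mathfrak n$. $AN$ acts simply transitively on $M$; the metric of $M$ transported to $AN$ is left invariant and, up to rescaling, equals $\langle X_{\mathfrak a},Y_{\mathfrak a}\rangle_{B_\theta}+\frac12\langle X_{\mathfrak n},Y_{\mathfrak n}\rangle_{B_\theta}$. $N$ with the induced left invariant metric is the nilpotent Iwasawa group of $M$. A foliation is homogeneous if its leaves are the orbits of an isometric action; submanifolds of $N$ are congruent if an isometry of $N$ maps one onto the other. For a nilpotent Lie group with left invariant metric, being a Ricci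 soliton is equivalent to $\operatorname{Ric}=D+c\,\mathrm{id}$ for some derivation $D$ of its Lie algebra and some $c\in\mathbb R$. *)

(* Defs.v *)
From HB Require Import structures.
From mathcomp Require Import all_boot all_order all_algebra.
From mathcomp Require Import all_classical all_reals all_analysis.
Set Implicit Arguments.
Unset Strict Implicit.
Unset Printing Implicit Defensive.
Import Order.TTheory GRing.Theory Num.Theory numFieldNormedType.Exports.
Local Open Scope classical_set_scope.
Local Open Scope ring_scope.

Section Coordinates.
Variables (R : realType) (m : nat).

Fixpoint Ck (W : normedModType R) (k : nat) (f : 'rV[R]_m -> W) : Prop :=
  if k is k'.+1 then
    (forall x v, derivable f x v) /\ (forall v, Ck k' (fun x => 'D_v f x))
  else continuous f.

Definition smooth (W : normedModType R) (f : 'rV[R]_m -> W) : Prop :=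
  forall k, Ck k f.

Definition partial (W : normedModType R) (a : 'I_m) (f : 'rV[R]_m -> W)
    (x : 'rV[R]_m) : W :=
  'D_(delta_mx 0 a) f x.

Variable h : 'rV[R]_m -> 'M[R]_m.

Definition dmetric (l i j : 'I_m) (x : 'rV[R]_m) : R :=
  partial l (fun y => h y i j) x.

(* Gamma^k_(i j) *)
Definition christoffel (k i j : 'I_m) (x : 'rV[R]_m) : R :=
  2^-1 * \sum_(l < m) invmx (h x) k l *
    (dmetric i j l x + dmetric j i l x - dmetric l i j x).

Definition ricci (x : 'rV[R]_m) : 'M[R]_m :=
  \matrix_(i, j) \sum_(k < m)
    (partial k (christoffel k i j) x - partial j (christoffel k i k) x
     + \sum_(l < m) (christoffel k k l x * christoffel l i j x
                     - christoffel k j l x * christoffel l i k x)).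

Definition lie_derivative (X : 'rV[R]_m -> 'rV[R]_m) (x : 'rV[R]_m) : 'M[R]_m :=
  \matrix_(i, j) \sum_(k < m)
    (X x 0 k * dmetric k i j x
     + h x k j * partial i (fun y => X y 0 k) x
     + h x i k * partial j (fun y => X y 0 k) x).

End Coordinates.

(* A Lie group of invertible d x d matrices with a left invariant metric: its
   underlying set, its tangent space at 1 (a Lie algebra of matrices) and the
   inner product there. The tangent space at p is p *m lie, and left
   translation identifies it with lie. *)
Record metric_group (R : realType) (d : nat) := MetricGroup {
  carrier : set 'M[R]_d;
  lie : {vspace 'M[R]_d};
  ip : 'M[R]_d -> 'M[R]_d -> R
}.

Section MatrixGroups.
Variables (R : realType) (d : nat).

Definition commutator (P Q : 'M[R]_d) : 'M[R]_d := P *m Q - Q *m P.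

Definition expm (P : 'M[R]_d) : 'M[R]_d :=
  limn (series (fun k : nat => (k`!%:R)^-1 *: P ^+ k)).

(* The connected Lie subgroup of GL_d with Lie algebra v is the subgroup
   generated by exp(v); v is closed under P |-> - P, so inverses of the
   generators need not be added. *)
Definition connected_subgroup (v : {vspace 'M[R]_d}) : set 'M[R]_d :=
  [set M | exists2 t : seq 'M[R]_d,
     (forall P, P \in t -> P \in v) & M = \prod_(P <- t) expm P].

Definition coset (p : 'M[R]_d) (S : set 'M[R]_d) : set 'M[R]_d :=
  [set p *m q | q in S].

Variable N : metric_group R d.

(* S is a Lie subgroup of N with Lie algebra s, not necessarily connected or
   closed: an abstract subgroup having the connected Lie subgroup of s as
   identity component, with at most countably many components. *)
Definition lie_subgroup (S : set 'M[R]_d) (s : {vspace 'M[R]_d}) : Prop :=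
  [/\ (s <= lie N)%VS /\
        (forall P Q, P \in s -> Q \in s -> commutator P Q \in s),
      S `<=` carrier N,
      [/\ S 1%:M, (forall p q, S p -> S q -> S (p *m q))
        & (forall p, S p -> S (invmx p))],
      connected_subgroup s `<=` S
    & exists c : nat -> 'M[R]_d,
        S `<=` \bigcup_i coset (c i) (connected_subgroup s)].

Definition left_cosets (S : set 'M[R]_d) : set (set 'M[R]_d) :=
  [set L | exists2 p, carrier N p & L = coset p S].

(* The connected Lie subgroup N is meant to be closed in GL_d, so that a smooth
   map into N is a smooth map into matrices with values in N. *)
Definition smooth_into (m : nat) (phi : 'rV[R]_m -> 'M[R]_d) : Prop :=
  smooth phi /\ forall x, carrier N (phi x).

Definition omega (m : nat) (phi : 'rV[R]_m -> 'M[R]_d) (a : 'I_m)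
    (x : 'rV[R]_m) : 'M[R]_d :=
  invmx (phi x) *m partial a phi x.

Definition induced_metric (m : nat) (phi : 'rV[R]_m -> 'M[R]_d)
    (x : 'rV[R]_m) : 'M[R]_m :=
  \matrix_(a, b) ip N (omega phi a x) (omega phi b x).

Definition immersion (m : nat) (phi : 'rV[R]_m -> 'M[R]_d) : Prop :=
  smooth_into phi /\ forall x u, 'D_u phi x = 0 -> u = 0.

(* f is smooth and its differential preserves the metric; since m and phi are
   arbitrary this may be tested on charts of N. *)
Definition smooth_isometric (f : 'M[R]_d -> 'M[R]_d) : Prop :=
  forall (m : nat) (phi : 'rV[R]_m -> 'M[R]_d), smooth_into phi ->
    smooth_into (f \o phi) /\ induced_metric (f \o phi) = induced_metric phi.

Definition inverse_on (f f' : 'M[R]_d -> 'M[R]_d) : Prop :=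
  forall p, carrier N p -> f' (f p) = p /\ f (f' p) = p.

Definition isometry (f : 'M[R]_d -> 'M[R]_d) : Prop :=
  smooth_isometric f /\
  exists2 f', smooth_isometric f' & inverse_on f f'.

Definition congruent (L L' : set 'M[R]_d) : Prop :=
  exists2 f, isometry f & f @` L = L'.

Definition isometry_group (G : set ('M[R]_d -> 'M[R]_d)) : Prop :=
  [/\ (forall f, G f -> isometry f), G id,
      (forall f f', G f -> G f' -> G (f \o f'))
    & (forall f, G f -> exists2 f', G f' & inverse_on f f')].

Definition orbit_of (G : set ('M[R]_d -> 'M[R]_d)) (p : 'M[R]_d) :
    set 'M[R]_d :=
  [set f p | f in G].

Definition homogeneous (F : set (set 'M[R]_d)) : Prop :=
  exists2 G, isometry_group G &
    forall L, F L <-> exists2 p, carrier N p & L = orbit_of G p.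

(* Inverse charts, defined on R^m, making L an injectively immersed
   m-dimensional submanifold of N. The last clause says that the changes of
   charts have open domains and are continuous; since the charts are
   immersions, the changes of charts are then smooth. *)
Definition atlas (m : nat) (L : set 'M[R]_d)
    (phi : nat -> 'rV[R]_m -> 'M[R]_d) : Prop :=
  [/\ forall i, immersion (phi i) /\ injective (phi i),
      L = \bigcup_i range (phi i)
    & forall i j x y (V : set 'rV[R]_m), phi i x = phi j y -> nbhs y V ->
        \forall x' \near x, (phi j @` V) (phi i x')].

(* For a leaf L of a foliation this is connectedness in the manifold topology of
   L: a smooth curve of N contained in L is smooth as a curve in L. *)
Definition smoothly_connected (L : set 'M[R]_d) : Prop :=
  forall p q, L p -> L q -> exists gamma : 'rV[R]_1 -> 'M[R]_d,
    [/\ smooth_into gamma, (forall t, L (gamma t)),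
        gamma 0 = p & gamma (const_mx 1) = q].

Definition tangent (m : nat) (phi : nat -> 'rV[R]_m -> 'M[R]_d)
    (p v : 'M[R]_d) : Prop :=
  exists i x u, phi i x = p /\ 'D_u (phi i) x = v.

Definition smooth_field (V : 'M[R]_d -> 'M[R]_d) : Prop :=
  (forall p, carrier N p -> invmx p *m V p \in lie N) /\
  forall (m : nat) (phi : 'rV[R]_m -> 'M[R]_d),
    smooth_into phi -> smooth (V \o phi).

(* A partition of N into injectively immersed submanifolds of one dimension m
   such that every vector tangent to a leaf extends to a smooth vector field on
   N tangent to all leaves; A provides the manifold structures of the leaves.
   Connectedness of the leaves is kept separate, as cosets of a disconnected
   subgroup are allowed too. *)
Definition foliation (m : nat) (F : set (set 'M[R]_d))
    (A : set 'M[R]_d -> nat -> 'rV[R]_m -> 'M[R]_d) : Prop :=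
  [/\ (forall p, carrier N p -> exists2 L, F L & L p),
      (forall L L', F L -> F L' -> L `&` L' !=set0 -> L = L'),
      (forall L, F L -> atlas L (A L))
    & forall L p v, F L -> tangent (A L) p v ->
        exists V, [/\ smooth_field V, V p = v &
          forall L' q, F L' -> L' q -> tangent (A L') q (V q)]].

(* Koszul's formula for the Levi-Civita connection of N on left invariant
   vector fields: koszul P Q Z is < nabla_P Q, Z >. *)
Definition koszul (P Q Z : 'M[R]_d) : R :=
  2^-1 * (ip N (commutator P Q) Z - ip N (commutator Q Z) P
          + ip N (commutator Z P) Q).

(* The component along the normal vector phi x *m nu of the covariant
   derivative of the field partial b phi along phi in the direction a. As
   partial b phi = phi *m omega phi b, this derivative is
   phi *m (partial a (omega phi b) + nabla_(omega phi a) (omega phi b)). *)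
Definition second_form (m : nat) (phi : 'rV[R]_m -> 'M[R]_d) (nu : 'M[R]_d)
    (a b : 'I_m) (x : 'rV[R]_m) : R :=
  ip N (partial a (omega phi b) x) nu
  + koszul (omega phi a x) (omega phi b x) nu.

Definition normal (m : nat) (phi : 'rV[R]_m -> 'M[R]_d) (x : 'rV[R]_m)
    (nu : 'M[R]_d) : Prop :=
  nu \in lie N /\ forall a, ip N (omega phi a x) nu = 0.

Definition mean_curvature (m : nat) (phi : 'rV[R]_m -> 'M[R]_d) (nu : 'M[R]_d)
    (x : 'rV[R]_m) : R :=
  \sum_(a < m) \sum_(b < m)
    invmx (induced_metric phi x) a b * second_form phi nu a b x.

Definition minimal (m : nat) (phi : nat -> 'rV[R]_m -> 'M[R]_d) : Prop :=
  forall i x nu, normal (phi i) x nu -> mean_curvature (phi i) nu x = 0.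

(* Ric = c h + L_X h for the induced metric h and a smooth tangent vector field
   on the submanifold; V is this field, X its expression in a chart. *)
Definition ricci_soliton (m : nat) (phi : nat -> 'rV[R]_m -> 'M[R]_d) : Prop :=
  exists (c : R) (V : 'M[R]_d -> 'M[R]_d), forall i,
    exists2 X : 'rV[R]_m -> 'rV[R]_m, smooth X & forall x,
      'D_(X x) (phi i) x = V (phi i x) /\
      ricci (induced_metric (phi i)) x =
        c *: induced_metric (phi i) x
        + lie_derivative (induced_metric (phi i)) X x.

End MatrixGroups.

(* The carrier is R^d, i.e. a basis of the Lie algebra has been chosen; vectors
   are columns, so that matrices act on the left. *)
Record lie_algebra (R : realType) (d : nat) := LieAlgebra {
  bracket :> 'cV[R]_d -> 'cV[R]_d -> 'cV[R]_d;
  bracket_linear : forall X c Y Z,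
    bracket X (c *: Y + Z) = c *: bracket X Y + bracket X Z;
  bracket_anti : forall X Y, bracket X Y = - bracket Y X;
  bracket_jacobi : forall X Y Z,
    bracket X (bracket Y Z) + bracket Y (bracket Z X)
    + bracket Z (bracket X Y) = 0
}.

Section SymmetricSpaces.
Variables (R : realType) (d : nat) (g : lie_algebra R d) (theta : 'M[R]_d).

Definition ad (X : 'cV[R]_d) : 'M[R]_d :=
  \matrix_(i, j) g X (delta_mx j 0) i 0.

Definition killing (X Y : 'cV[R]_d) : R := \tr (ad X *m ad Y).

Definition Btheta (X Y : 'cV[R]_d) : R := - killing X (theta *m Y).

Definition in_k (X : 'cV[R]_d) : Prop := theta *m X = X.
Definition in_p (X : 'cV[R]_d) : Prop := theta *m X = - X.

Definition cartan_involution : Prop :=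
  [/\ theta *m theta = 1%:M,
      forall X Y, theta *m g X Y = g (theta *m X) (theta *m Y)
    & forall X, X != 0 -> 0 < Btheta X X].

(* (g, theta) is the infinitesimal description of an irreducible symmetric
   space of non-compact type G/K, with G the identity component of the isometry
   group: theta is a Cartan involution of g (so that g is semisimple), k
   contains no nonzero ideal of g (G acts effectively) and the isotropy
   representation of k on p is irreducible. *)
Definition irreducible_noncompact_type : Prop :=
  [/\ cartan_involution,
      (forall I : {vspace 'cV[R]_d}, (forall X Y, Y \in I -> g X Y \in I) ->
         (forall X, X \in I -> in_k X) -> I = 0%VS),
      (exists2 X, X != 0 & in_p X)
    & (forall V : {vspace 'cV[R]_d}, (forall X, X \in V -> in_p X) ->
         (forall X Y, in_k X -> Y \in V -> g X Y \in V) ->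
         V = 0%VS \/ (forall X, in_p X -> X \in V))].

Definition abelian_in_p (a : {vspace 'cV[R]_d}) : Prop :=
  (forall X, X \in a -> in_p X) /\
  (forall X Y, X \in a -> Y \in a -> g X Y = 0).

Definition maximal_abelian (a : {vspace 'cV[R]_d}) : Prop :=
  abelian_in_p a /\ forall b, abelian_in_p b -> (a <= b)%VS -> b = a.

(* Only the values of lambda on a matter. *)
Definition root_space (a : {vspace 'cV[R]_d}) (lambda : 'cV[R]_d -> R) :
    set 'cV[R]_d :=
  [set X | forall H, H \in a -> g H X = lambda H *: X].

Definition root (a : {vspace 'cV[R]_d}) (lambda : 'cV[R]_d -> R) : Prop :=
  (exists2 H, H \in a & lambda H != 0) /\
  (exists2 X, X != 0 & root_space a lambda X).

(* The roots positive on the Weyl chamber of a regular vector H0. *)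
Definition positive_roots (a : {vspace 'cV[R]_d})
    (Sigma_pos : set ('cV[R]_d -> R)) : Prop :=
  exists2 H0, H0 \in a /\ (forall lambda, root a lambda -> lambda H0 != 0) &
    forall lambda, Sigma_pos lambda <-> root a lambda /\ 0 < lambda H0.

Definition sum_of_root_spaces (a : {vspace 'cV[R]_d})
    (Sigma_pos : set ('cV[R]_d -> R)) (n : {vspace 'cV[R]_d}) : Prop :=
  forall X, X \in n <-> exists2 t : seq 'cV[R]_d,
    (forall Y, Y \in t -> exists2 lambda, Sigma_pos lambda
                                        & root_space a lambda Y)
    & X = \sum_(Y <- t) Y.

(* G is centreless, hence identified by Ad with the subgroup Int(g) of GL(g)
   generated by exp(ad g); its connected subgroup with Lie algebra n becomes the
   one with Lie algebra ad(n). As ad is injective, the inner product of n is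
   carried over to ad(n). The scalar r is the rescaling of the metric of M. *)
Definition iwasawa_group (n : {vspace 'cV[R]_d}) (r : R) : metric_group R d :=
  let lie_n := (linfun ad @: n)%VS in
  {| carrier := connected_subgroup lie_n;
     lie := lie_n;
     ip := fun P Q =>
       r * (2^-1 * Btheta ((linfun ad)^-1%VF P) ((linfun ad)^-1%VF Q)) |}.

End SymmetricSpaces.

(* Main.v *)
(**
  Let n be the Lie algebra of N and s that of S. All of ad(n) strictly raises
  the eigenvalues of ad(H0) for a regular H0 in the Weyl chamber, so long
  products of elements of ad(n) vanish; exp and log on N are then polynomials,
  and N = exp(ad n). A subalgebra of codimension one of a nilpotent Lie algebra
  is an ideal containing all brackets, so by Baker-Campbell-Hausdorff log is
  additive modulo s: log induces a homomorphism N -> n/s with kernel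
  exp(s), the identity component of S. Hence S is normal in N and its left
  cosets are the orbits of S acting by left translations, which are isometries
  of N and make the cosets congruent. For a unit normal nu, the mean curvature
  is the trace of ad(nu) restricted to the ideal s, and it vanishes because
  ad(nu) is nilpotent. Any atlas of S, in particular one by Ricci solitons, is
  carried to all cosets by left translation.
*)
Require Import Defs.
From HB Require Import structures.
From mathcomp Require Import all_boot all_order all_algebra.
From mathcomp Require Import all_classical all_reals all_analysis.
Set Implicit Arguments.
Unset Strict Implicit.
Unset Printing Implicit Defensive.
Import Order.TTheory GRing.Theory Num.Theory numFieldNormedType.Exports.
Local Open Scope classical_set_scope.
Local Open Scope ring_scope.

(** The soliton clause starts from an arbitrary atlas of [S], so minimality cannot be checked in
    exponential charts only: every smooth map into [S] must be shown to have velocities that,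
    translated back to the identity, lie in [s]. Since [S] need not be closed in [N], this is
    obtained from the class of the logarithm modulo [s]. Once [omega] takes its values in [s], so do
    its derivatives, and the second fundamental form reduces to Koszul's formula on the Lie algebra.
    Baker-Campbell-Hausdorff is needed only modulo a subspace w containing all commutators of [v].
    With w = [v] it makes exp([v]) closed under products, with w = [s] it makes log additive modulo
    [s]. This weak form follows from differentiating a curve with polynomial entries, which is why
    exp and log are truncated polynomials over a commutative ring and all derivatives in that
    argument are formal. *)

(** * Truncated exponential and logarithm *)

(** Satisfied both by the ground field R and by {poly R}, the ring over which
    the curve exp(uP) exp(uQ) of Baker-Campbell-Hausdorff lives. *)
Definition nat_unit (C : comUnitRingType) :=
  forall n, (n.+1%:R : C) \is a GRing.unit.

Definition eq_upto (C : nzRingType) (K : nat) (p q : {poly C}) :=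
  forall i, (i < K)%N -> p`_i = q`_i.

Definition exp_poly (C : comUnitRingType) (K : nat) : {poly C} :=
  \poly_(i < K) (i`!%:R)^-1.

(** The series of log (1 + X). *)
Definition log_poly (C : comUnitRingType) (K : nat) : {poly C} :=
  \poly_(i < K) (if i is j.+1 then (-1) ^+ j / j.+1%:R else 0).

Section TruncatedSeries.
Variables (C : comUnitRingType) (hC : nat_unit C).
Implicit Types p q : {poly C}.

Lemma fact_unit n : (n`!%:R : C) \is a GRing.unit.
Proof. by rewrite -(prednK (fact_gt0 n)); apply: hC. Qed.

Lemma eq_upto_mul K p p' q q' :
  eq_upto K p p' -> eq_upto K q q' -> eq_upto K (p * q) (p' * q').
Proof.
move=> ep eq i iK; rewrite !coefM; apply: eq_bigr => -[j /= ji] _.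
by rewrite ep ?eq//; [apply: leq_ltn_trans iK; rewrite leq_subr|apply: leq_trans iK].
Qed.

Lemma eq_upto_exp0 K p : p`_0 = 0 -> eq_upto K (p ^+ K) 0.
Proof.
move=> p0; elim: K => [//|K IH] i; rewrite ltnS => iK.
rewrite exprSr coefM coef0 big1// => -[j /=]; rewrite ltnS => ji _.
have [jK|Kj] := ltnP j K; first by rewrite IH// coef0 mul0r.
have -> : (i - j = 0)%N by apply/eqP; rewrite subn_eq0 (leq_trans iK).
by rewrite p0 mulr0.
Qed.

Lemma eq_upto_horner (A : algType C) K p q (z : A) :
  z ^+ K = 0 -> eq_upto K p q -> horner_alg z p = horner_alg z q.
Proof.
move=> zK pq; rewrite -(poly_take_drop K p) -(poly_take_drop K q).
have -> : take_poly K p = take_poly K q.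
  by apply/polyP=> i; rewrite !coef_take_poly; case: ifP => // /pq.
by rewrite !rmorphD !rmorphM !rmorphXn/= horner_algX zK !mulr0.
Qed.

Lemma deriv_exp_poly k :
  (exp_poly C k.+1)^`() = exp_poly C k.+1 - (k`!%:R)^-1 *: 'X^k.
Proof.
apply/polyP => i; rewrite coef_deriv coefB coefZ coefXn !coef_poly ltnS.
rewrite [(i < k.+1)%N]ltnS; have [ik|ki|->] := ltngtP i k.
- rewrite mulr0 subr0 factS natrM invrM ?hC ?fact_unit//.
  by rewrite -[_ *+ i.+1]mulr_natr divrK // hC.
- by rewrite mulr0 subr0 mul0rn.
- by rewrite mulr1 subrr mul0rn.
Qed.

(** The derivative is the geometric sum of the powers of -X. *)
Lemma deriv_log_poly k : ('X + 1) * (log_poly C k.+1)^`() = 1 - (- 'X) ^+ k.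
Proof.
have cX i j : ((- 'X : {poly C}) ^+ j)`_i = (-1) ^+ j * (i == j)%:R.
  by rewrite (exprNn 'X) -(rmorphN1 polyC) -rmorphXn/= coefCM coefXn.
have -> : (log_poly C k.+1)^`() = \sum_(i < k) (- 'X) ^+ i.
  apply/polyP => i; rewrite coef_deriv coef_poly coef_sum ltnS.
  have [ik|ki] := ltnP i k.
    rewrite (bigD1 (Ordinal ik))//= big1 ?addr0 => [|j ji].
      by rewrite cX eqxx mulr1 -[_ *+ i.+1]mulr_natr divrK.
    move: ji; rewrite cX -val_eqE /= eq_sym => /negbTE ->; rewrite mulr0//.
  rewrite big1 ?mul0rn// => j _; rewrite cX gtn_eqF ?mulr0//.
  exact: leq_trans (ltn_ord j) ki.
have := subrX1 (- 'X : {poly C}) k; rewrite -opprB => /(congr1 -%R).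
by rewrite opprK => ->; rewrite -mulNr opprB opprK addrC.
Qed.

Lemma exp_poly0 k : (exp_poly C k.+1)`_0 = 1.
Proof. by rewrite coef_poly invr1. Qed.

Lemma log_poly0 k : (log_poly C k)`_0 = 0.
Proof. by rewrite coef_poly if_same. Qed.

Lemma coef0_comp p q : q`_0 = 0 -> (p \Po q)`_0 = p`_0.
Proof. by move=> q0; rewrite -!horner_coef0 horner_comp [q.[0]]horner_coef0 q0. Qed.

Lemma eq_upto_deriv k p q :
  p`_0 = q`_0 -> eq_upto k p^`() q^`() -> eq_upto k.+1 p q.
Proof.
move=> pq0 pq [//|i]; rewrite ltnS => /pq; rewrite !coef_deriv.
by rewrite -[_ *+ _ in X in X -> _]mulr_natr -[X in _ = X -> _]mulr_natr => /(mulIr (hC i)).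
Qed.

(** The composite g satisfies (1 + X) g' = g up to truncation terms of degree at least k, and g(0) =
    1. On coefficients this is a recursion whose solution is 1 + X. *)
Lemma exp_log_poly k :
  eq_upto k.+1 (exp_poly C k.+1 \Po log_poly C k.+1) (1 + 'X).
Proof.
set l := log_poly C k.+1; set g := _ \Po l.
have l0 : l`_0 = 0 by rewrite log_poly0.
have g0 : g`_0 = 1 by rewrite coef0_comp// exp_poly0.
have gE : eq_upto k (('X + 1) * g^`()) g.
  have -> : ('X + 1) * g^`() = (g - (k`!%:R)^-1 *: l ^+ k) * (1 - (- 'X) ^+ k).
    rewrite -deriv_log_poly -/l /g deriv_comp mulrCA; congr (_ * _).
    by rewrite deriv_exp_poly linearB linearZ /= comp_Xn_poly.
  rewrite -[X in eq_upto _ _ X]mulr1; apply: eq_upto_mul => i ik.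
    by rewrite coefB coefZ eq_upto_exp0// coef0 mulr0 subr0.
  by rewrite coefB eq_upto_exp0 ?coef0 ?subr0// coefN coefX oppr0.
apply: eq_upto_deriv; first by rewrite g0 coefD coef1 coefX addr0.
rewrite derivD derivX (_ : 1^`() = 0) ?add0r; last by rewrite -(polyC1 C) derivC.
have g1 i : (i < k)%N -> g`_i.+1 *+ i.+1 + (if i is j.+1 then g`_i *+ i else 0) = g`_i.
  move=> /gE; rewrite mulrDl mul1r coefD coefXM !coef_deriv addrC.
  by case: i.
elim=> [|i IH] ik; first by have := g1 0 ik; rewrite addr0 g0 coef_deriv coef1.
have := g1 _ ik; have := IH (ltnW ik); rewrite !coef_deriv coef1/=.
case: i IH ik => [|i] IH ik; rewrite ?mulr1n !coef1 /= => e.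
  by move=> h; apply: (addIr g`_1); rewrite h add0r.
rewrite e addr0 => ->.
by apply: (mulIr (hC i.+1)); rewrite mul0r mulr_natr.
Qed.

(** The derivative of exp(-X) exp(X) consists of truncation terms of degree at least k only. *)
Lemma expN_exp_poly k :
  eq_upto k.+1 ((exp_poly C k.+1 \Po (- 'X)) * exp_poly C k.+1) 1.
Proof.
have X0 : (- 'X : {poly C})`_0 = 0 by rewrite coefN coefX oppr0.
apply: eq_upto_deriv.
  by rewrite coefM big_ord1 subnn coef0_comp// exp_poly0 mul1r coef1.
move=> i ik; rewrite derivM deriv_comp derivN derivX deriv_exp_poly.
rewrite linearB linearZ/= comp_Xn_poly mulrN1 derivC coef0 mulrBr mulNr mulrBl.
rewrite opprB addrA subrK coefB -scalerAl -scalerAr !coefZ coefMXn ik mulr0 subr0.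
by rewrite exprNn -mulrA mulrCA coefXnM ik mulr0.
Qed.

End TruncatedSeries.

(** With e the truncated exponential, e f' = e' = e modulo X^k, so X^k divides e (f' - 1), and e is
    coprime to X because e(0) = 1. This divisibility argument takes place over a field, whereas
    [exp_log_poly] also serves over [{poly R}]. *)
Lemma log_exp_poly (F : fieldType) k : nat_unit F ->
  eq_upto k.+1 (log_poly F k.+1 \Po (exp_poly F k.+1 - 1)) 'X.
Proof.
move=> hF; set e := exp_poly F k.+1; set l := log_poly F k.+1; set f := _ \Po _.
have e0 : (e - 1)`_0 = 0 by rewrite coefB exp_poly0 coef1 subrr.
have fE : eq_upto k (e * (f^`() - 1)) 0.
  have -> : e * (f^`() - 1) = (1 - (- (e - 1)) ^+ k) * e^`() - e.
    rewrite mulrBr mulr1; congr (_ - _); rewrite deriv_comp mulrA.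
    congr (_ * _); last first.
      by rewrite derivB (_ : 1^`() = 0) ?subr0// -(polyC1 F) derivC.
    have := congr1 (fun p => p \Po (e - 1)) (deriv_log_poly hF k).
    rewrite comp_polyM comp_polyD comp_polyX comp_polyB -polyC1 comp_polyC.
    rewrite polyC1 subrK => ->; congr (_ - _).
    by rewrite (rmorphXn (comp_poly (e - 1)))/= raddfN/= comp_polyX.
  move=> i ik; rewrite mulrBl mul1r deriv_exp_poly// -/e -addrAC coefB coef0.
  rewrite addrC addrA addNr add0r coefN coefZ coefXn (ltn_eqF ik) mulr0 oppr0 sub0r.
  apply/eqP; rewrite oppr_eq0; apply/eqP.
  rewrite coefM big1// => -[j /= ji] _; rewrite eq_upto_exp0 ?coef0 ?mul0r//.
    by rewrite coefN e0 oppr0.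
  by apply: leq_ltn_trans ik.
apply: (eq_upto_deriv hF).
  by rewrite coef0_comp// log_poly0 coefX.
rewrite derivX => i ik; apply/eqP; rewrite -subr_eq0 -coefB; apply/eqP.
have : 'X^k %| e * (f^`() - 1).
  apply/dvdpP; exists (drop_poly k (e * (f^`() - 1))).
  rewrite -[LHS](poly_take_drop k) -[RHS]add0r; congr (_ + _).
  apply/polyP => j; rewrite coef_take_poly coef0.
  by case: ifP => // /fE ->; rewrite coef0.
rewrite Gauss_dvdpr; first by move=> /dvdpP[q ->]; rewrite coefMXn ik.
apply: coprimep_expl; rewrite coprimep_sym coprimepX.
by rewrite /root horner_coef0 exp_poly0 oner_neq0.
Qed.

(** * Exponentials of nilpotent elements and their derivatives *)

Section NilpotentExp.
Variables (C : comUnitRingType) (hC : nat_unit C) (A : algType C) (k : nat).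
Implicit Types x y z : A.

Lemma scale_natI n x y : n.+1%:R *: x = n.+1%:R *: y -> x = y.
Proof. by move=> /(congr1 ( *:%R n.+1%:R^-1)); rewrite !scalerA mulVr ?hC// !scale1r. Qed.

Definition nexp z : A := horner_alg z (exp_poly C k.+1).
Definition nlog z : A := horner_alg (z - 1) (log_poly C k.+1).

Lemma horner_alg_comp z (p q : {poly C}) :
  horner_alg z (p \Po q) = horner_alg (horner_alg z q) p.
Proof.
elim/poly_ind: p => [|p c IH]; first by rewrite comp_poly0 !rmorph0.
rewrite comp_poly_MXaddC !rmorphD !rmorphM /= IH horner_algX.
by rewrite !horner_algC.
Qed.

Lemma nexpK z : (z - 1) ^+ k.+1 = 0 -> nexp (nlog z) = z.
Proof.
move=> zk; rewrite /nexp /nlog -horner_alg_comp.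
rewrite (eq_upto_horner zk (exp_log_poly hC (k := k))).
by rewrite rmorphD rmorph1 /= horner_algX addrC subrK.
Qed.

Lemma nexpN z : z ^+ k.+1 = 0 -> nexp (- z) * nexp z = 1.
Proof.
move=> zk; rewrite /nexp -[- z](_ : horner_alg z (- 'X) = _); last first.
  by rewrite rmorphN /= horner_algX.
rewrite -horner_alg_comp.
have := eq_upto_horner zk (expN_exp_poly hC (k := k)).
by rewrite rmorphM rmorph1.
Qed.

Definition dpow z i : A := i`!%:R^-1 *: z ^+ i.

Lemma dpowS z i : i.+1%:R *: dpow z i.+1 = z * dpow z i.
Proof.
rewrite /dpow scalerA factS natrM invrM ?hC ?(fact_unit hC)//.
by rewrite mulrCA divrr ?hC// mulr1 exprS scalerAr.
Qed.

Lemma dpowSr z i : i.+1%:R *: dpow z i.+1 = dpow z i * z.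
Proof. by rewrite dpowS /dpow -scalerAr -scalerAl -exprS -exprSr. Qed.

Lemma nexpE z : nexp z = \sum_(i < k.+1) dpow z i.
Proof.
rewrite /nexp /exp_poly poly_def rmorph_sum /=; apply: eq_bigr => i _.
by rewrite -mul_polyC rmorphM rmorphXn /= horner_algC horner_algX mulr_algl.
Qed.

(** (- ad y)^n x / n!, the degree n part of exp(-y) x exp(y). *)
Fixpoint adpow y x n : A :=
  if n is n'.+1 then n'.+1%:R^-1 *: (adpow y x n' * y - y * adpow y x n') else x.

Lemma adpow_comm y x n : x * y = y * x -> adpow y x n.+1 = 0.
Proof.
move=> xy; elim: n => [|n IH]; first by rewrite /= xy subrr scaler0.
by rewrite [LHS]/= -/(adpow y x n.+1) IH mul0r mulr0 subr0 scaler0.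
Qed.

(** This is the product rule for exp(-ty) F(t), where F has the coefficients [f], read at t^n: the
    factor n+1 splits as i + (n+1-i), the first part differentiating the exponential and the second
    F. *)
Lemma conv_dpowS y (f : nat -> A) n :
  n.+1%:R *: \sum_(i < n.+2) dpow (- y) i * f (n.+1 - i)%N =
  \sum_(i < n.+1) dpow (- y) i * ((n - i).+1%:R *: f (n - i).+1)
  - y * \sum_(i < n.+1) dpow (- y) i * f (n - i)%N.
Proof.
rewrite scaler_sumr.
under eq_bigr => i _ do rewrite -{1}(subnK (ltn_ord i : i <= n.+1)%N) natrD scalerDl.
rewrite big_split /= big_ord_recr /= subnn scale0r addr0; congr (_ + _).
  by apply: eq_bigr => i _; rewrite -scalerAr subSn// -ltnS.
rewrite big_ord_recl scale0r add0r -mulNr mulr_sumr; apply: eq_bigr => i _.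
by rewrite scalerAl dpowS mulrA subSS.
Qed.

Lemma conv_adpow y x n :
  \sum_(i < n.+1) dpow (- y) i * (x * dpow y (n - i)) = adpow y x n.
Proof.
elim: n => [|n IH].
  by rewrite big_ord1 /dpow /= invr1 !scale1r !expr0 mul1r mulr1.
apply: (@scale_natI n); rewrite (conv_dpowS y (fun i => x * dpow y i)) IH /=.
rewrite scalerA divrr ?hC// scale1r -IH mulr_suml; congr (_ - _).
by apply: eq_bigr => i _; rewrite scalerAr dpowSr !mulrA.
Qed.

(** The sums are values at 1 of polynomials over [A]; evaluation at the central element 1 is
    multiplicative although [A] is not commutative. *)
Lemma sum_conv (f g : nat -> A) :
  (forall i, (k < i)%N -> f i = 0) -> (forall i, (k < i)%N -> g i = 0) ->
  (\sum_(i < k.+1) f i) * (\sum_(i < k.+1) g i) =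
  \sum_(n < (k.+1 + k.+1)) \sum_(i < n.+1) f i * g (n - i)%N.
Proof.
move=> f0 g0; pose p := \poly_(i < k.+1) f i; pose q := \poly_(i < k.+1) g i.
have -> : \sum_(i < k.+1) f i = p.[1].
  by rewrite horner_poly; apply: eq_bigr => i _; rewrite expr1n mulr1.
have -> : \sum_(i < k.+1) g i = q.[1].
  by rewrite horner_poly; apply: eq_bigr => i _; rewrite expr1n mulr1.
rewrite -hornerM_comm; last by rewrite /comm_poly mulr1 mul1r.
rewrite (@horner_coef_wide _ (k.+1 + k.+1)).
  apply: eq_bigr => n _; rewrite expr1n mulr1 coefM; apply: eq_bigr => i _.
  rewrite !coef_poly; case: ltnP => [_|/f0 ->]; rewrite ?mul0r//.
  by case: ltnP => [//|/g0 ->]; rewrite !mulr0.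
apply: leq_trans (size_polyMleq _ _) _.
by rewrite (leq_trans (leq_pred _))// leq_add// size_poly.
Qed.

Lemma dpow_eq0 y i : y ^+ k.+1 = 0 -> (k < i)%N -> dpow y i = 0.
Proof. by move=> yk /subnK <-; rewrite /dpow exprD yk mulr0 scaler0. Qed.

Lemma nexp_conj y x : y ^+ k.+1 = 0 ->
  nexp (- y) * x * nexp y = \sum_(n < k.+1 + k.+1) adpow y x n.
Proof.
move=> yk; rewrite -mulrA !nexpE mulr_sumr (sum_conv (f := dpow (- y)) (g := fun i => x * dpow y i)).
- by apply: eq_bigr => n _; exact: conv_adpow.
- by move=> i ki; rewrite dpow_eq0// exprNn yk mulr0.
- by move=> i ki; rewrite dpow_eq0// mulr0.
Qed.

Variable D : {additive A -> A}.
Hypothesis DM : forall x y, D (x * y) = D x * y + x * D y.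

Lemma der_scale n x : D (n.+1%:R *: x) = n.+1%:R *: D x.
Proof. by rewrite !scaler_nat raddfMn. Qed.

Lemma conv_der_dpow y n :
  \sum_(i < n.+1) dpow (- y) i * D (dpow y (n - i)%N) =
  if n is n'.+1 then n'.+1%:R^-1 *: adpow y (D y) n' else 0.
Proof.
case: n => [|n].
  rewrite big_ord1 /dpow /= invr1 !scale1r expr0.
  rewrite mul1r; apply: (addrI (D 1)); rewrite addr0.
  by have := DM 1 1; rewrite !mulr1 mul1r => <-.
apply: (@scale_natI n); rewrite (conv_dpowS y (fun i => D (dpow y i))).
rewrite scalerA divrr ?hC// scale1r -conv_adpow.
under eq_bigr => i _ do rewrite -der_scale dpowS DM mulrDr.
(* The half of the Leibniz rule in which D passes over the first factor y cancels the last term of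
   [conv_dpowS]. *)
rewrite big_split /= mulr_sumr -[RHS]addr0 -addrA; congr (_ + _).
rewrite -sumrB big1// => i _; rewrite !mulrA.
suff -> : dpow (- y) i * y = y * dpow (- y) i by rewrite subrr.
by have := dpowS (- y) i; rewrite dpowSr mulNr mulrN => /oppr_inj.
Qed.

(** The derivative of the exponential map: exp(-y) D(exp y) is the sum of the (- ad y)^n (D y) /
    (n+1)!. *)
Lemma nexp_der y : y ^+ k.+1 = 0 ->
  nexp (- y) * D (nexp y) =
  \sum_(n < k + k.+1) n.+1%:R^-1 *: adpow y (D y) n.
Proof.
move=> yk; rewrite !nexpE raddf_sum (sum_conv (f := dpow (- y)) (g := fun i => D (dpow y i))).
- rewrite addSn big_ord_recl conv_der_dpow add0r.
  by apply: eq_bigr => n _; exact: conv_der_dpow.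
- by move=> i ki; rewrite dpow_eq0// exprNn yk mulr0.
- by move=> i ki; rewrite dpow_eq0// raddf0.
Qed.

End NilpotentExp.

(** * Nilpotent algebras and Baker-Campbell-Hausdorff *)

Section Raising.
Variables (C : comUnitRingType) (A : algType C) (G : A -> Prop) (K : nat).
Implicit Types x y z b : A.

(** An element raises the filtration of A by the left annihilators of long words
    in G when it is a combination of nonempty words; such elements form a
    nilpotent algebra without having to conjugate to triangular matrices. *)
Definition kills (j : nat) (b : A) := forall l : seq A,
  (forall x, x \in l -> G x) -> (K <= j + size l)%N -> b * \prod_(x <- l) x = 0.

Definition raising (y : A) := forall j b, kills j b -> kills j.+1 (b * y).

Lemma raising_gen x : G x -> raising x.
Proof.
move=> Gx j b kb l Gl; rewrite addSnnS => sl; rewrite -mulrA.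
have := kb (x :: l); rewrite big_cons; apply=> // z.
by rewrite inE => /predU1P[->|/Gl].
Qed.

Lemma raising0 : raising 0.
Proof. by move=> j b _ l _ _; rewrite mulr0 mul0r. Qed.

Lemma raisingD x y : raising x -> raising y -> raising (x + y).
Proof.
by move=> rx ry j b kb l Gl sl; rewrite mulrDr mulrDl (rx _ _ kb)// (ry _ _ kb)// addr0.
Qed.

Lemma raisingZ c x : raising x -> raising (c *: x).
Proof. by move=> rx j b kb l Gl sl; rewrite -scalerAr -scalerAl (rx _ _ kb)// scaler0. Qed.

Lemma raisingM x y : raising x -> raising y -> raising (x * y).
Proof.
move=> rx ry j b kb; rewrite mulrA => l Gl sl.
by apply: (ry _ _ (rx _ _ kb)) => //; rewrite (leq_trans sl)// leq_add2r leqW.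
Qed.

Lemma raising_sum (I : Type) (s : seq I) (P : pred I) (f : I -> A) :
  (forall i, P i -> raising (f i)) -> raising (\sum_(i <- s | P i) f i).
Proof. by move=> rf; apply: big_ind => //; [exact: raising0|exact: raisingD]. Qed.

Lemma raising_horner z (p : {poly C}) : p`_0 = 0 -> raising z -> raising (horner_alg z p).
Proof.
move=> p0 rz; rewrite -[p]coefK poly_def rmorph_sum /=; apply: raising_sum => -[i /= ip] _.
rewrite -mul_polyC rmorphM rmorphXn /= horner_algC horner_algX mulr_algl.
case: i ip => [|i] ip; first by rewrite p0 scale0r; exact: raising0.
apply: raisingZ; elim: i {ip} => [//|i IH].
by rewrite exprS; apply: raisingM.
Qed.

Lemma horner_alg0 (p : {poly C}) : horner_alg (0 : A) p = (p`_0)%:A.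
Proof.
elim/poly_ind: p => [|p c _]; first by rewrite rmorph0 coef0 scale0r.
rewrite rmorphD rmorphM /= horner_algX mulr0 add0r horner_algC.
by rewrite coefD coefMX coefC add0r.
Qed.

Lemma raising_nexp k z : raising z -> raising (nexp k z - 1).
Proof.
move=> rz; have -> : nexp k z - 1 = horner_alg z (exp_poly C k.+1 - 1).
  by rewrite rmorphB rmorph1.
by apply: raising_horner; rewrite // coefB exp_poly0 coef1 subrr.
Qed.

Lemma raising_nlog k z : raising (z - 1) -> raising (nlog k z).
Proof. by move=> rz; apply: raising_horner; rewrite // log_poly0. Qed.

Lemma raising_mul1 x y : raising (x - 1) -> raising (y - 1) -> raising (x * y - 1).
Proof.
move=> rx ry; have -> : x * y - 1 = (x - 1) * (y - 1) + (x - 1) + (y - 1).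
  rewrite mulrBr mulr1 subrK mulrBl mul1r.
  by rewrite addrA subrK.
by do 2?apply: raisingD => //; apply: raisingM.
Qed.

Lemma raising_nil y : kills 0 1 -> raising y -> y ^+ K = 0.
Proof.
move=> k1 ry; have /(_ [::]) : kills K (y ^+ K).
  suff kj j : kills j (y ^+ j) by [].
  elim: j => [|j IH]; first by rewrite expr0.
  by rewrite exprSr; apply: ry.
by rewrite big_nil mulr1; apply => //; rewrite addn0.
Qed.

End Raising.

Section MapAlg.
Variables (C C' : comUnitRingType) (f : {rmorphism C -> C'}) (n k : nat).
Hypothesis hC : nat_unit C.

Lemma map_horner_alg (z : 'M[C]_n.+1) p :
  map_mx f (horner_alg z p) = horner_alg (map_mx f z) (map_poly f p).
Proof.
elim/poly_ind: p => [|p c IH]; first by rewrite !rmorph0.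
rewrite !rmorphD !rmorphM /= IH !map_polyX map_polyC /=.
by rewrite !horner_algX !horner_algC map_mxZ map_mx1.
Qed.

Lemma map_nexp (z : 'M[C]_n.+1) : map_mx f (nexp k z) = nexp k (map_mx f z).
Proof.
rewrite map_horner_alg; congr horner_alg; apply/polyP => i.
rewrite coef_map !coef_poly /=; case: ifP => _; rewrite ?rmorph0//.
by rewrite rmorphV ?fact_unit//= rmorph_nat.
Qed.

Lemma map_nlog (z : 'M[C]_n.+1) : map_mx f (nlog k z) = nlog k (map_mx f z).
Proof.
rewrite map_horner_alg map_mxB map_mx1; congr horner_alg; apply/polyP => i.
rewrite coef_map !coef_poly /=; case: ifP => _; rewrite ?rmorph0//.
case: i => [|i]; rewrite ?rmorph0//.
by rewrite rmorphM rmorphV ?hC//= rmorph_nat rmorph_sign.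
Qed.

End MapAlg.

Section BCH.
Variables (R : numFieldType) (n k : nat).
Notation A := 'M[R]_n.+1.
Notation B := 'M[{poly R}]_n.+1.

Lemma nat_unit_num : nat_unit R.
Proof. by move=> i; rewrite unitfE pnatr_eq0. Qed.

Lemma nat_unit_poly : nat_unit {poly R}.
Proof.
move=> i; rewrite -(rmorph_nat polyC) poly_unitE/= coefC eqxx size_polyC.
by rewrite unitfE pnatr_eq0.
Qed.

Definition coefmx i (b : B) : A := map_mx (coefp i) b.

Lemma coefmxD i x y : coefmx i (x + y) = coefmx i x + coefmx i y.
Proof. by rewrite /coefmx map_mxD. Qed.

Lemma coefmxB i x y : coefmx i (x - y) = coefmx i x - coefmx i y.
Proof. by rewrite /coefmx map_mxB. Qed.

Lemma coefmx_sum i (I : Type) (s : seq I) (P : pred I) (f : I -> B) :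
  coefmx i (\sum_(j <- s | P j) f j) = \sum_(j <- s | P j) coefmx i (f j).
Proof. by rewrite /coefmx raddf_sum. Qed.

Lemma coefmxM m x y : coefmx m (x * y) = \sum_(i < m.+1) coefmx i x * coefmx (m - i) y.
Proof.
apply/matrixP => i j; rewrite !mxE /= coef_sum summxE.
under eq_bigr do rewrite coefM.
rewrite exchange_big /=; apply: eq_bigr => l _; rewrite !mxE.
by apply: eq_bigr => h _; rewrite !mxE.
Qed.

Lemma coefmxMr m x y : coefmx m (x * y) = \sum_(i < m.+1) coefmx (m - i) x * coefmx i y.
Proof.
rewrite coefmxM (reindex_inj rev_ord_inj) /=; apply: eq_bigr => i _.
by rewrite subSS subKn// -ltnS.
Qed.

Lemma coefmxZ m c x : coefmx m (c%:P *: x) = c *: coefmx m x.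
Proof. by apply/matrixP => i j; rewrite !mxE /= coefCM. Qed.

Lemma inv_natE i : (i.+1%:R^-1 : {poly R}) = (i.+1%:R^-1)%:P.
Proof.
by rewrite -(rmorph_nat polyC) -(rmorphV polyC)//= nat_unit_num.
Qed.

Definition mxderiv : B -> B := map_mx deriv.
HB.instance Definition _ := GRing.Additive.on mxderiv.

Lemma mxderivM x y : mxderiv (x * y) = mxderiv x * y + x * mxderiv y.
Proof.
apply/matrixP => i j; rewrite !mxE raddf_sum -big_split /=.
by apply: eq_bigr => l _; rewrite !mxE derivM.
Qed.

Lemma nexp_mxderiv (y : B) : y ^+ k.+1 = 0 ->
  nexp k (- y) * mxderiv (nexp k y) =
  \sum_(m < k + k.+1) m.+1%:R^-1 *: adpow y (mxderiv y) m.
Proof. exact: (nexp_der nat_unit_poly mxderivM). Qed.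

Lemma coefmx_deriv i x : coefmx i (mxderiv x) = i.+1%:R *: coefmx i.+1 x.
Proof. by apply/matrixP => a b; rewrite !mxE /= coef_deriv mulr_natl. Qed.

Lemma coefmx_const i (P : A) : coefmx i (map_mx polyC P) = if i == 0%N then P else 0.
Proof. by apply/matrixP => a b; rewrite !mxE /= coefC; case: eqP; rewrite ?mxE. Qed.

Lemma coefmx_X i (P : A) : coefmx i ('X *: map_mx polyC P) = if i == 1%N then P else 0.
Proof.
apply/matrixP => a b; rewrite !mxE /= coefXM coefC.
by case: i => [|[|i]] //=; rewrite ?mxE.
Qed.

Variables v w : {vspace A}.
Hypothesis wv : (w <= v)%VS.
Hypothesis vvw : forall P Q, P \in v -> Q \in v -> P * Q - Q * P \in w.
Hypothesis vnil : forall l : seq A, (forall P, P \in l -> P \in v) ->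
  (k.+1 <= size l)%N -> \prod_(P <- l) P = 0.

Lemma kills_start : kills (fun P => P \in v) k.+1 0 1.
Proof. by move=> l vl sl; rewrite vnil// mulr0. Qed.

Lemma raising_v P : P \in v -> raising (fun P => P \in v) k.+1 P.
Proof. exact: raising_gen. Qed.

Lemma nil_v P : P \in v -> P ^+ k.+1 = 0.
Proof. by move=> /raising_v; apply: raising_nil; apply: kills_start. Qed.

Definition const_gen (b : B) := exists2 P, P \in v & b = map_mx polyC P.

Lemma kills_poly : kills const_gen k.+1 0 1.
Proof.
move=> l Gl sl; rewrite mul1r.
have [l' vl' lE] : exists2 l' : seq A, forall P, P \in l' -> P \in v &
    l = map (map_mx polyC) l'.
  elim: l Gl {sl} => [|b l IH] Gl; first by exists [::].
  have [|l' vl' ->] := IH; first by move=> x xl; apply: Gl; rewrite inE xl orbT.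
  have [|P vP ->] := Gl b; first by rewrite inE eqxx.
  by exists (P :: l') => // Q; rewrite inE => /predU1P[->|/vl'].
rewrite lE size_map in sl *.
by rewrite big_map -(rmorph_prod (map_mx polyC)) vnil ?rmorph0.
Qed.

Lemma raising_X P : P \in v -> raising const_gen k.+1 ('X *: map_mx polyC P).
Proof. by move=> vP; apply/raisingZ/raising_gen; exists P. Qed.

Lemma coefmx_bracket (x z : B) m : coefmx 0 z = 0 ->
  (forall i, (i <= m)%N -> coefmx i z \in v) -> (forall i, (i < m)%N -> coefmx i x \in v) ->
  forall i, (i <= m)%N -> coefmx i (x * z - z * x) \in w.
Proof.
move=> z0 zv xv i im; rewrite coefmxB coefmxMr [X in _ - X]coefmxM -sumrB.
apply: memv_suml => -[[|j] /= ji] _; first by rewrite z0 mulr0 mul0r subr0 mem0v.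
apply: vvw; last by apply: zv; rewrite (leq_trans _ im).
by apply: xv; rewrite (leq_trans _ im)// ltn_subrL; exact: leq_ltn_trans (leq0n j) ji.
Qed.

Lemma coefmx_adpow (x z : B) m : coefmx 0 z = 0 ->
  (forall i, (i <= m)%N -> coefmx i z \in v) -> (forall i, (i < m)%N -> coefmx i x \in v) ->
  forall l i, (i <= m)%N -> coefmx i (adpow z x l.+1) \in w.
Proof.
move=> z0 zv xv; have wv' := subvP wv; elim=> [|l IH] i im.
  by rewrite /= inv_natE coefmxZ memvZ// (coefmx_bracket (m := m)).
rewrite [adpow _ _ _]/= inv_natE coefmxZ memvZ// (coefmx_bracket (m := m))//.
by move=> j jm; apply: wv'; apply: IH; apply: ltnW.
Qed.

Lemma coefmx_eval (b : B) : (forall m, coefmx m b \in w) -> map_mx (horner_eval 1) b \in w.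
Proof.
move=> bw; pose N := \max_i \max_j size (b i j).
suff -> : map_mx (horner_eval 1) b = \sum_(m < N) coefmx m b by apply: memv_suml.
apply/matrixP => i j; rewrite summxE mxE /horner_eval (@horner_coef_wide _ N).
  by apply: eq_bigr => m _; rewrite mxE expr1n mulr1.
by apply: leq_trans (leq_bigmax i); apply: (leq_bigmax (F := fun j => size (b i j)) j).
Qed.

(** With c = exp(uP) exp(uQ) and z = log c, the coefficients of c^-1 c' lie in
    P + Q + w[u], and c^-1 c' is z' plus brackets of z' with z. As z(0) = 0, the
    coefficient of u^m in these brackets only involves the coefficients of z up
    to degree m, so z' is determined modulo w degree by degree. *)
Lemma bch P Q : P \in v -> Q \in v ->
  nlog k (nexp k P * nexp k Q) - (P + Q) \in w.
Proof.
move=> vP vQ.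
pose p : B := 'X *: map_mx polyC P; pose q : B := 'X *: map_mx polyC Q.
pose c := nexp k p * nexp k q; pose z := nlog k c.
have hpC := nat_unit_poly; have hC := nat_unit_num.
have rp : raising const_gen k.+1 p by exact: raising_X.
have rq : raising const_gen k.+1 q by exact: raising_X.
have rc : raising const_gen k.+1 (c - 1).
  by apply: raising_mul1; apply: raising_nexp.
have nilr (y : B) : raising const_gen k.+1 y -> y ^+ k.+1 = 0.
  by apply: raising_nil; exact: kills_poly.
have zk : z ^+ k.+1 = 0 by apply/nilr/raising_nlog.
have Ez : nexp k z = c by rewrite nexpK// nilr.
have ev0 (b : B) : coefmx 0 b = map_mx (horner_eval 0) b.
  by apply/matrixP => i j; rewrite !mxE /= /horner_eval horner_coef0.
have z0 : coefmx 0 z = 0.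
  have e0 (X : A) : map_mx (horner_eval 0) ('X *: map_mx polyC X) = 0.
    by apply/matrixP => i j; rewrite !mxE /horner_eval hornerM hornerX mul0r.
  rewrite ev0 map_nlog// /c map_mxM !map_nexp// !e0 /nexp.
  rewrite !horner_alg0 exp_poly0 scale1r mulmx1 /nlog subrr horner_alg0.
  by rewrite log_poly0 scale0r.
pose PQ : B := map_mx polyC (P + Q).
(* Computed from the product, c^-1 c' is exp(-uQ) P exp(uQ) + Q. *)
have Ddc : nexp k (- z) * mxderiv c =
    \sum_(m < k.+1 + k.+1) adpow q (map_mx polyC P) m + map_mx polyC Q.
  have -> : nexp k (- z) = nexp k (- q) * nexp k (- p).
    have cc : c * (nexp k (- q) * nexp k (- p)) = 1.
      rewrite /c -mulrA [X in _ * X]mulrA -{1}(opprK q) -{1}(opprK p).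
      have nil' y : raising const_gen k.+1 y -> (- y) ^+ k.+1 = 0.
        by move=> ry; rewrite exprNn (nilr y)// mulr0.
      by rewrite nexpN ?nil'// mul1r nexpN ?nil'.
    rewrite -[LHS]mulr1 -cc mulrA -Ez nexpN// mul1r//.
  have dE X : X \in v -> nexp k (- ('X *: map_mx polyC X)) *
      mxderiv (nexp k ('X *: map_mx polyC X)) = map_mx polyC X.
    move=> vX; rewrite nexp_mxderiv; last by apply/nilr/raising_X.
    have -> : mxderiv ('X *: map_mx polyC X) = map_mx polyC X.
      by apply/matrixP => i j; rewrite !mxE derivM derivX derivC mulr0 addr0 mul1r.
    rewrite addnS big_ord_recl [X in X + _]/= invr1 scale1r big1 ?addr0// => i _.
    by rewrite lift0 adpow_comm ?scaler0// -scalerAl -scalerAr.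
  rewrite /c mxderivM mulrDr -nexp_conj//; last exact: nilr.
  congr (_ + _).
    by rewrite -(dE P vP) !mulrA.
  rewrite -[RHS](dE Q vQ) -!mulrA; congr (_ * _); rewrite mulrA.
  by rewrite nexpN ?mul1r// nilr.
have wE m : (forall i, (i <= m)%N -> coefmx i z \in v) ->
    coefmx m (mxderiv z) - coefmx m PQ \in w.
  move=> zv.
  have dzv i : (i < m)%N -> coefmx i (mxderiv z) \in v.
    by move=> im; rewrite coefmx_deriv memvZ// zv.
  (* The same c^-1 c' is now expanded through z. Splitting off the terms of index 0 isolates z' on
     one side and P + Q on the other; all remaining terms are iterated brackets, with coefficients
     in [w]. *)
  have := Ddc; rewrite -Ez (nexp_mxderiv zk) addnS big_ord_recl.
  rewrite [X in X + _ = _]/= invr1 scale1r addSn big_ord_recl [adpow _ _ _]/= => /(congr1 (coefmx m)).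
  rewrite !coefmxD !coefmx_sum => dz.
  have -> : coefmx m (mxderiv z) - coefmx m PQ =
    \sum_(i < k + k.+1) coefmx m (adpow q (map_mx polyC P) (lift ord0 i))
    - \sum_(i < k + k) coefmx m ((lift ord0 i).+1%:R^-1 *: adpow z (mxderiv z) (lift ord0 i)).
    apply/eqP; rewrite subr_eq addrAC eq_sym subr_eq dz /PQ map_mxD coefmxD.
    by rewrite addrA; apply/eqP; congr (_ + _); rewrite addrC.
  apply: memvB; apply: memv_suml => i _.
    apply: (coefmx_adpow (m := m)) => // [|j _|j _].
    - by rewrite coefmx_X.
    - by rewrite coefmx_X; case: ifP => _; rewrite ?mem0v.
    - by rewrite coefmx_const; case: ifP => _; rewrite ?mem0v.
  by rewrite inv_natE coefmxZ memvZ//; apply: (coefmx_adpow (m := m)).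
have zv m : coefmx m z \in v.
  have [j] := ubnP m; elim: j m => [//|j IH] [|m]; first by rewrite z0 mem0v.
  rewrite ltnS => mj; have /wE/(subvP wv) : forall i, (i <= m)%N -> coefmx i z \in v.
    by move=> i im; apply: IH; apply: leq_ltn_trans mj.
  have vPQ : coefmx m PQ \in v.
    by rewrite coefmx_const; case: ifP => _; rewrite ?mem0v ?memvD.
  move=> /memvD/(_ vPQ); rewrite subrK coefmx_deriv.
  move=> /(memvZ m.+1%:R^-1); by rewrite scalerA mulVf ?pnatr_eq0// scale1r.
(* At u = 1 the curve becomes exp(P) exp(Q). *)
have ev1 (X : A) : map_mx (horner_eval 1) ('X *: map_mx polyC X) = X.
  by apply/matrixP => i j; rewrite !mxE /horner_eval hornerM hornerX hornerC mul1r.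
have -> : nlog k (nexp k P * nexp k Q) - (P + Q) =
    map_mx (horner_eval 1) (z - 'X *: PQ).
  by rewrite map_mxB map_nlog// map_mxM !map_nexp// !ev1.
apply: coefmx_eval => -[|m].
  by rewrite coefmxB coefmx_X z0 subr0 mem0v.
have := wE m (fun i _ => zv i); rewrite coefmx_deriv => /(memvZ m.+1%:R^-1).
rewrite scalerBr scalerA mulVf ?pnatr_eq0// scale1r coefmxB coefmx_const coefmx_X.
by rewrite eqSS; case: m => [|m]; rewrite /= ?invr1 ?scale1r ?scaler0.
Qed.

End BCH.

(** * Subalgebras of codimension one *)

(** X - t divides X^K - t^K = X^K as matrices. Taking determinants, the characteristic polynomial
    divides a power of X, hence equals X^m, and its subleading coefficient is minus the trace. *)
Lemma trace_nilpotent (F : fieldType) m (t : 'M[F]_m) K : t ^+ K = 0 -> \tr t = 0.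
Proof.
case: m t => [|m] t tK; first by rewrite /mxtrace big_ord0.
have : char_poly t %| ('X - 0%:P) ^+ (K * m.+1).
  have e : ('X%:M : 'M[{poly F}]_m.+1) ^+ K =
      char_poly_mx t * \sum_(i < K) ('X%:M) ^+ (K.-1 - i) * (map_mx polyC t) ^+ i.
    have := @subrXX_comm _ ('X%:M : 'M[{poly F}]_m.+1) (map_mx polyC t) K.
    have -> : map_mx polyC t ^+ K = 0 by rewrite -rmorphXn /= tK rmorph0.
    rewrite subr0; apply.
    exact: comm_scalar_mx.
  rewrite subr0 exprM; have := congr1 determinant e.
  have -> : ('X%:M : 'M[{poly F}]_m.+1) ^+ K = ('X^K)%:M.
    by rewrite -[RHS]/(scalar_mx _) rmorphXn.
  by rewrite det_scalar det_mulmx => ->; apply: dvdp_mulr.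
move=> /dvdp_exp_XsubCP[j [_ ]].
rewrite eqp_monic ?char_poly_monic ?monic_exp ?monicXsubC// => /eqP tj.
have jm : j = m.+1.
  by have := size_char_poly t; rewrite tj size_exp_XsubC => -[].
apply/eqP; rewrite -oppr_eq0 -char_poly_trace//= tj jm subr0 coefXn.
by rewrite (ltn_eqF (ltnSn m)).
Qed.

Section Codim1.
Variables (F : fieldType) (n k : nat).
Notation A := 'M[F]_n.+1.
Variables v s : {vspace A}.
Hypothesis vnil : forall l : seq A, (forall P, P \in l -> P \in v) ->
  (k.+1 <= size l)%N -> \prod_(P <- l) P = 0.
Hypothesis vv : forall P Q, P \in v -> Q \in v -> P * Q - Q * P \in v.
Hypothesis ss : forall P Q, P \in s -> Q \in s -> P * Q - Q * P \in s.
Hypothesis sv : (s <= v)%VS.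
Hypothesis codim1 : \dim v = (\dim s).+1.

(** Here [b] is annihilated as if it counted for j letters of a word over [v]. Letters are allowed
    on both sides since a commutator adds its letter on either side. *)
Definition sandwich_null (j : nat) (b : A) := forall l1 l2 : seq A,
  (forall P, P \in l1 -> P \in v) -> (forall P, P \in l2 -> P \in v) ->
  (k.+1 <= size l1 + size l2 + j)%N ->
  (\prod_(P <- l1) P) * b * (\prod_(P <- l2) P) = 0.

Lemma sandwich_start b : b \in v -> sandwich_null 0 b.
Proof.
move=> vb l1 l2 v1 v2; rewrite addn0 => sl.
have := vnil (l := l1 ++ b :: l2); rewrite big_cat big_cons /= mulrA; apply.
  by move=> P; rewrite mem_cat inE => /or3P[/v1|/eqP->|/v2].
by rewrite size_cat /= addnS leqW.
Qed.

Lemma sandwich_bracket j b Q : Q \in v -> sandwich_null j b ->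
  sandwich_null j.+1 (b * Q - Q * b).
Proof.
move=> vQ nb l1 l2 v1 v2; rewrite addnS => sl; rewrite mulrBr mulrBl.
have := nb l1 (Q :: l2); rewrite big_cons !mulrA => -> //; last 2 first.
- by move=> P; rewrite inE => /predU1P[->|/v2].
- by rewrite /= addnS.
have := nb (rcons l1 Q) l2; rewrite big_rcons /= ?mulrA => -> //.
- by rewrite subrr.
- by move=> P; rewrite mem_rcons inE => /predU1P[->|/v1].
- by rewrite size_rcons addSn.
Qed.

Lemma sandwich_nil b : sandwich_null k.+1 b -> b = 0.
Proof.
by move=> /(_ [::] [::]); rewrite !big_nil mul1r mulr1; apply.
Qed.

Definition brackets (b : A) (l : seq A) := foldl (fun b Q => b * Q - Q * b) b l.

Lemma brackets_v b l : b \in v -> (forall Q, Q \in l -> Q \in v) -> brackets b l \in v.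
Proof.
elim: l b => [//|Q l IH] b vb vl; rewrite /brackets /=; apply: IH.
  by apply: vv => //; apply: vl; rewrite inE eqxx.
by move=> P Pl; apply: vl; rewrite inE Pl orbT.
Qed.

Lemma sandwich_brackets b j l : sandwich_null j b -> (forall Q, Q \in l -> Q \in v) ->
  sandwich_null (j + size l) (brackets b l).
Proof.
elim: l b j => [|Q l IH] b j nb vl; first by rewrite addn0.
rewrite /= addnS -addSn; apply: IH.
  by apply: sandwich_bracket => //; apply: vl; rewrite inE eqxx.
by move=> P Pl; apply: vl; rewrite inE Pl orbT.
Qed.

(** Y is an iterated bracket of an element of v with elements of s, the longest
    that is not yet in s. *)
Lemma normalizer_grows :
  exists Y, [/\ Y \in v, Y \notin s & forall Q, Q \in s -> Y * Q - Q * Y \in s].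
Proof.
have svP := subvP sv.
apply: contrapT => noY; suff vs : (v <= s)%VS.
  by have := dimvS vs; rewrite codim1 ltnn.
(* Descending induction on the length: if all brackets with m+1 elements of [s] lie in [s], then a
   bracket with m elements outside [s] would be the Y assumed not to exist. Length 0 gives v <=
   s. *)
have chain m : (forall b l, b \in v -> (forall Q, Q \in l -> Q \in s) -> size l = m ->
    brackets b l \in s) -> (v <= s)%VS.
  elim: m => [|m IH] H; first by apply/subvP => b vb; apply: (H b [::]).
  apply: IH => b l vb sl lm; apply: contrapT => /negP nb; apply: noY.
  exists (brackets b l); split => //.
    by apply: brackets_v => // Q /sl/svP.
  move=> Q sQ; have := H b (rcons l Q); rewrite /brackets foldl_rcons; apply => //.
    by move=> P; rewrite mem_rcons inE => /predU1P[->|/sl].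
  by rewrite size_rcons lm.
apply: (chain k.+1) => b l vb sl lm.
have := sandwich_brackets (sandwich_start vb) (fun Q h => svP _ (sl Q h)).
by rewrite lm => /sandwich_nil ->; rewrite mem0v.
Qed.

(** A normalizing Y outside [s] spans [v] modulo [s] because the codimension is one, so brackets
    reduce to [s, s], [Y, s] and [Y, Y] = 0. *)
Lemma codim1_commutator P Q : P \in v -> Q \in v -> P * Q - Q * P \in s.
Proof.
have [Y [vY sY nY]] := normalizer_grows.
have vE : (v <= s + <[Y]>)%VS.
  have sub : (s + <[Y]> <= v)%VS by rewrite subv_add sv -memvE.
  rewrite -(geq_leqif (dimv_leqif_sup sub)) codim1.
  rewrite ltn_neqAle dimvS ?addvSl// andbT.
  rewrite (dimv_leqif_sup (addvSl s <[Y]>)) subv_add subvv /= -memvE //.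
have dec Z : Z \in v -> exists2 a, a \in s & exists y, Z = a + y *: Y.
  by move=> /(subvP vE)/memv_addP[a sa [_ /vlineP[y ->] ->]]; exists a => //; exists y.
move=> /dec[a sa [x ->]] /dec[b sb [y ->]].
pose br (M N : A) := M * N - N * M; rewrite -/(br _ _).
have brDl M M' N : br (M + M') N = br M N + br M' N.
  by rewrite /br mulrDl mulrDr opprD addrACA.
have brDr M N N' : br M (N + N') = br M N + br M N'.
  by rewrite /br mulrDl mulrDr opprD addrACA.
have brZl c M N : br (c *: M) N = c *: br M N.
  by rewrite /br -scalerAl -scalerAr scalerBr.
have brZr c M N : br M (c *: N) = c *: br M N.
  by rewrite /br -scalerAl -scalerAr scalerBr.
rewrite brDl !brDr !brZl !brZr {4}/br subrr !scaler0 addr0.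
have h1 : br a b \in s by exact: ss.
have h2 : br Y b \in s by exact: nY.
have h3 : br a Y \in s by rewrite /br -opprB memvN nY.
by apply: memvD; [apply: memvD; [|exact: memvZ]|exact: memvZ].
Qed.

Lemma iter_ad_eq0 nu b : nu \in v -> b \in v ->
  iter k.+1 (fun X => nu * X - X * nu) b = 0.
Proof.
move=> vnu vb; apply: sandwich_nil.
elim: k.+1 => [|j IH]; first exact: sandwich_start.
rewrite iterS -opprB => l1 l2 v1 v2 sl.
by rewrite mulrN mulNr (sandwich_bracket vnu IH)// oppr0.
Qed.

End Codim1.

(** * Contraction of a nilpotent map with an inverse Gram matrix *)

Section TraceForm.
Variables (F : numFieldType) (V : vectType F) (m K : nat) (s : {vspace V}).
Variables (b : V -> V -> F) (T : V -> V) (om : 'I_m -> V).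
Hypothesis bl : forall c x y z, b (c *: x + y) z = c * b x z + b y z.
Hypothesis bC : forall x y, x \in s -> y \in s -> b x y = b y x.
Hypothesis b_pos : forall x, x \in s -> x != 0 -> 0 < b x x.
Hypothesis Tl : forall c x y, T (c *: x + y) = c *: T x + T y.
Hypothesis Ts : forall x, x \in s -> T x \in s.
Hypothesis TK : forall x, x \in s -> iter K T x = 0.
Hypothesis om_s : forall a, om a \in s.
Hypothesis om_free : forall c : 'I_m -> F, \sum_a c a *: om a = 0 -> forall a, c a = 0.
Hypothesis dim_s : \dim s = m.

Lemma om_span x : x \in s -> exists c : 'I_m -> F, x = \sum_a c a *: om a.
Proof.
pose X := [tuple om a | a < m].
have XE (i : 'I_m) : X`_i = om i by rewrite -tnth_nth tnth_mktuple.
have bX : basis_of s X.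
  rewrite basisEfree size_tuple dim_s leqnn andbT; apply/andP; split.
    apply/freeP => c; under eq_bigr do rewrite XE; exact: om_free.
  by apply/span_subvP => x' /tnthP[i ->]; rewrite tnth_mktuple.
move=> /(coord_basis bX) ->; exists (fun a => coord X a x).
by apply: eq_bigr => i _; rewrite XE.
Qed.

Definition gram : 'M[F]_m := \matrix_(i, j) b (om i) (om j).

Lemma b_sum (c : 'I_m -> F) z : b (\sum_a c a *: om a) z = \sum_a c a * b (om a) z.
Proof.
have b0 z' : b 0 z' = 0.
  by have := bl (-1) 0 0 z'; rewrite scaler0 addr0 mulN1r addNr.
apply: (big_rec2 (fun x y => b x z = y)) => // i x y _ <-.
by rewrite bl.
Qed.

Lemma gram_unit : gram \in unitmx.
Proof.
rewrite -row_free_unit -kermx_eq0; apply/eqP/row_matrixP => i; rewrite row0.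
set u := row i _; have : u *m gram = 0.
  by rewrite -row_mul mulmx_ker row0.
move: u => u ug; pose x := \sum_a u 0 a *: om a.
have bx j : b x (om j) = 0.
  have /matrixP/(_ 0 j) := ug; rewrite !mxE => <-; rewrite b_sum.
  by apply: eq_bigr => a _; rewrite mxE.
have sx : x \in s by apply: memv_suml => a _; rewrite memvZ.
have bxx : b x x = 0.
  rewrite {1}/x b_sum big1// => a _; rewrite bC// bx mulr0//.
have x0 : x = 0.
  by apply/eqP; apply: contraTT isT => /(b_pos sx); rewrite bxx ltxx.
by apply/rowP => a; rewrite (om_free x0) mxE.
Qed.

(** If t is the matrix of [T] in the basis [om], the numbers b (T om_i) (om_j) are the entries of t
    * gram, so the contraction is the trace of t, which is nilpotent as [T] is. *)
Lemma trace_form_nilpotent :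
  \sum_(i < m) \sum_(j < m) invmx gram i j * b (T (om i)) (om j) = 0.
Proof.
have T_ex : exists t : 'M[F]_m, forall i, T (om i) = \sum_c t i c *: om c.
  have /all_sig[t tE] i : { c : 'I_m -> F | T (om i) = \sum_a c a *: om a }.
    by apply: cid; apply/om_span/Ts.
  exists (\matrix_(i, c) t i c) => i; rewrite tE.
  by apply: eq_bigr => c _; rewrite mxE.
have [t tE] := T_ex.
have T_sum (c : 'I_m -> F) : T (\sum_a c a *: om a) = \sum_a c a *: T (om a).
  have T0 : T 0 = 0.
    by have := Tl (-1) 0 0; rewrite scaler0 addr0 scaleN1r addNr.
  by apply: (big_rec2 (fun x y => T x = y)) => // i x y _ <-; rewrite Tl.
have tX j i : iter j T (om i) = \sum_c (t ^+ j) i c *: om c.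
  elim: j => [|j IH].
    rewrite expr0 (bigD1 i)//= mxE eqxx scale1r big1 ?addr0// => c ci.
    by rewrite mxE eq_sym (negbTE ci) scale0r.
  rewrite iterS IH T_sum exprSr.
  under eq_bigr do rewrite tE scaler_sumr.
  rewrite exchange_big /=; apply: eq_bigr => c _; rewrite mxE scaler_suml.
  by apply: eq_bigr => l _; rewrite scalerA.
have tK : t ^+ K = 0.
  apply/matrixP => i c; rewrite mxE; have := TK (om_s i); rewrite tX.
  by move=> /om_free.
have gT : gram^T = gram by apply/matrixP => i j; rewrite !mxE bC.
transitivity (\tr t); last exact: trace_nilpotent tK.
rewrite -[t in RHS](mulmxK gram_unit).
rewrite -[in RHS]mxtrace_tr trmx_mul trmx_inv gT.
rewrite /mxtrace; apply: eq_bigr => i _; rewrite mxE; apply: eq_bigr => j _.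
by rewrite mxE tE b_sum mxE; congr (_ * _); apply: eq_bigr => l _; rewrite mxE.
Qed.

End TraceForm.

(** * Calculus of matrix valued functions *)

Lemma cvg_bigsum (R : realType) (W : normedModType R) (T I : Type)
    (F : set_system T) {FF : Filter F} (r : seq I) (f : I -> T -> W) (l : I -> W) :
  (forall i, f i x @[x --> F] --> l i) ->
  (\sum_(i <- r) f i x) @[x --> F] --> \sum_(i <- r) l i.
Proof.
move=> fl; elim: r => [|i r IH].
  by rewrite big_nil; under eq_fun do rewrite big_nil; exact: cvg_cst.
by rewrite big_cons; under eq_fun do rewrite big_cons; exact: cvgD.
Qed.

Section MatrixLimits.
Variables (R : realType) (T : Type) (F : set_system T).
Context {FF : Filter F}.

Lemma cvg_mxP m n (f : T -> 'M[R]_(m, n)) (l : 'M[R]_(m, n)) :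
  (f @ F --> l) <-> forall i j, f x i j @[x --> F] --> l i j.
Proof.
split=> [fl i j|fl].
  exact: (continuous_cvg _ (@coord_continuous _ _ _ i j l)).
apply/cvgrPdist_le => /= e e0; near=> x.
rewrite /Num.Def.normr/= mx_normrE (bigmax_le _ (ltW e0))//= => i _.
rewrite !mxE; move: i; near: x; apply: filter_forall => /= i.
exact: ((cvgrPdist_le _ _).1 (fl i.1 i.2)).
Unshelve. all: by end_near. Qed.

Lemma cvg_mulmx m n p (f : T -> 'M[R]_(m, n)) (g : T -> 'M[R]_(n, p)) (a : 'M[R]_(m, n)) (b : 'M[R]_(n, p)) :
  f @ F --> a -> g @ F --> b -> (f x *m g x) @[x --> F] --> a *m b.
Proof.
move=> /cvg_mxP fa /cvg_mxP gb; apply/cvg_mxP => i j; rewrite mxE.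
under eq_fun do rewrite mxE.
by apply: cvg_bigsum => k; apply: cvgM.
Qed.

End MatrixLimits.

Lemma continuous_mulmx (R : realType) (V : topologicalType) m n p
    (f : V -> 'M[R]_(m, n)) (g : V -> 'M[R]_(n, p)) :
  continuous f -> continuous g -> continuous (fun x => f x *m g x).
Proof. by move=> cf cg x; apply: cvg_mulmx; [exact: cf|exact: cg]. Qed.

Lemma linear_mx_continuous (R : realType) m n (W : normedModType R)
  (f : {linear 'M[R]_(m, n) -> W}) : continuous f.
Proof.
move=> M; have fE N : f N = \sum_i \sum_j N i j *: f (delta_mx i j).
  rewrite {1}[N]matrix_sum_delta !linear_sum; apply: eq_bigr => i _.
  by rewrite !linear_sum; apply: eq_bigr => j _; rewrite linearZ.
rewrite (_ : (f : 'M[R]_(m, n) -> W) = fun N => \sum_i \sum_j N i j *: f (delta_mx i j));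
  last by apply/funext.
have FM : Filter (nbhs M) := nbhs_filter M.
apply: cvg_bigsum => i; apply: cvg_bigsum => j; apply: cvgZr_tmp.
exact: coord_continuous.
Qed.

Section Smooth.
Variables (R : realType) (m : nat).
Notation V := 'rV[R]_m.

Lemma smoothP (W : normedModType R) (f : V -> W) :
  smooth f <-> [/\ continuous f, forall x v, derivable f x v &
                  forall v, smooth (fun x => 'D_v f x)].
Proof.
split=> [sf|[cf df sf]].
  by split; [exact: (sf 0%N)|exact: (sf 1%N).1|move=> v k; exact: (sf k.+1).2].
by case=> [|k]; [exact: cf|split=> // v; exact: sf].
Qed.

Lemma smooth_cst (W : normedModType R) (c : W) : smooth (fun _ : V => c).
Proof.
move=> k; elim: k c => [|k IH] c; first exact: cst_continuous.
split=> [x v|v]; first exact: derivable_cst.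
rewrite (_ : 'D_v _ = fun=> 0); first exact: IH.
by apply/funext => x; rewrite derive_cst.
Qed.

Lemma CkD (W : normedModType R) k (f g : V -> W) :
  Ck k f -> Ck k g -> Ck k (fun x => f x + g x).
Proof.
elim: k f g => [|k IH] f g.
  by move=> /= cf cg x; exact: cvgD (cf x) (cg x).
move=> [df Df] [dg Dg]; split=> [x v|v]; first exact: derivableD.
rewrite (_ : 'D_v _ = fun x => 'D_v f x + 'D_v g x).
  by apply: IH; [exact: Df|exact: Dg].
by apply/funext => x; rewrite -deriveD.
Qed.

Lemma smoothD (W : normedModType R) (f g : V -> W) :
  smooth f -> smooth g -> smooth (fun x => f x + g x).
Proof. by move=> sf sg k; apply: CkD. Qed.

Lemma smooth_linear a b (f : {linear V -> 'M[R]_(a, b)}) : smooth f.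
Proof.
apply/smoothP; have cf : continuous f by exact: linear_mx_continuous.
have df x : differentiable f x by apply: linear_differentiable.
split=> // [x v|v]; first exact/diff_derivable/df.
rewrite (_ : 'D_v _ = fun=> f v); first exact: smooth_cst.
by apply/funext => x; rewrite deriveE ?diff_lin//; apply: df.
Qed.

Lemma is_derive_mulmx (U : normedModType R) a b c (f : U -> 'M[R]_(a, b))
    (g : U -> 'M[R]_(b, c)) x v :
  derivable f x v -> derivable g x v ->
  is_derive x v (fun x => f x *m g x) ('D_v f x *m g x + f x *m 'D_v g x).
Proof.
move=> df dg.
have fij := (derivable_mxP f x v).1 df; have gij := (derivable_mxP g x v).1 dg.
have dij i j : is_derive x v (fun x => (f x *m g x) i j)
    (('D_v f x *m g x + f x *m 'D_v g x) i j).
  rewrite (_ : (fun x => (f x *m g x) i j) = \sum_k (fun x => f x i k * g x k j)); last first.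
    by apply/funext => y; rewrite mxE fct_sumE.
  have h k : is_derive x v (fun x => f x i k * g x k j)
      ('D_v f x i k * g x k j + f x i k * 'D_v g x k j).
    have h1 : is_derive x v (fun x => f x i k) ('D_v f x i k).
      by rewrite derive_mx// mxE; apply: derivableP.
    have h2 : is_derive x v (fun x => g x k j) ('D_v g x k j).
      by rewrite derive_mx// mxE; apply: derivableP.
    by apply: is_derive_eq; rewrite addrC; congr (_ + _); rewrite /GRing.scale /= mulrC.
  apply: is_derive_eq; rewrite !mxE -big_split /=; apply: eq_bigr => k _; reflexivity.
apply: DeriveDef.
  by apply/derivable_mxP => i j; case: (dij i j).
rewrite derive_mx; last by apply/derivable_mxP => i j; case: (dij i j).
by apply/matrixP => i j; rewrite mxE; apply: derive_val.
Qed.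

Lemma smooth_mulmx a b c (f : V -> 'M[R]_(a, b)) (g : V -> 'M[R]_(b, c)) :
  smooth f -> smooth g -> smooth (fun x => f x *m g x).
Proof.
move=> sf sg k; elim: k f g sf sg => [|k IH] f g /smoothP[cf df Df] /smoothP[cg dg Dg].
  exact: continuous_mulmx.
have H x v := is_derive_mulmx (df x v) (dg x v).
split=> [x v|v]; first by case: (H x v).
rewrite (_ : 'D_v _ = fun x => 'D_v f x *m g x + f x *m 'D_v g x).
  by apply: CkD; apply: IH => //; apply/smoothP.
by apply/funext => x; case: (H x v).
Qed.

Lemma smooth_mulmxl a b c (p : 'M[R]_(a, b)) (g : V -> 'M[R]_(b, c)) :
  smooth g -> smooth (fun x => p *m g x).
Proof. by apply: smooth_mulmx; apply: smooth_cst. Qed.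

Lemma derive_mulmxl (U : normedModType R) a b c (p : 'M[R]_(a, b))
    (g : U -> 'M[R]_(b, c)) x v :
  derivable g x v -> 'D_v (fun x => p *m g x) x = p *m 'D_v g x.
Proof.
move=> dg; have := is_derive_mulmx (derivable_cst p x v) dg.
by rewrite derive_cst mul0mx add0r => h; apply: derive_val.
Qed.

Lemma smooth_horner n (f : V -> 'M[R]_n.+1) (p : {poly R}) :
  smooth f -> smooth (fun x => horner_alg (f x) p).
Proof.
move=> sf; elim/poly_ind: p => [|p c IH].
  by under eq_fun do rewrite rmorph0; exact: smooth_cst.
under eq_fun do rewrite rmorphD rmorphM /= horner_algX horner_algC.
by apply: smoothD (smooth_cst _); apply: smooth_mulmx.
Qed.

End Smooth.

Section DirectionalDerivative.
Variables (R : realType) (V : normedModType R).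

Lemma is_derive_line (W : normedModType R) (f : V -> W) (u y : V) (t : R) :
  derivable f (t *: u + y) u ->
  is_derive t (1 : R) (fun h => f (h *: u + y)) ('D_u f (t *: u + y)).
Proof.
have e : (fun h : R => h^-1 *: (((fun h => f (h *: u + y)) \o shift t) (h *: 1) - f (t *: u + y)))
   = (fun h => h^-1 *: ((f \o shift (t *: u + y)) (h *: u) - f (t *: u + y))).
  apply/funext => h /=; congr (_ *: (f _ - _)).
  by rewrite [h *: 1]mulr1 scalerDl addrA.
by move=> df; apply: DeriveDef; rewrite /derivable /derive e.
Qed.

Lemma mean_value (f : V -> R) (u y : V) (c : R) : (forall x, derivable f x u) ->
  exists2 z : R, `|z| <= `|c| & f (c *: u + y) - f y = c * 'D_u f (z *: u + y).
Proof.
move=> df; pose phi h := f (h *: u + y); pose dphi h := 'D_u f (h *: u + y).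
have dP t : is_derive t (1 : R) phi (dphi t) by apply: is_derive_line.
have cP (i : interval R) : {within [set` i], continuous phi}.
  by apply: derivable_within_continuous => t _; case: (dP t).
have phi0 : phi 0 = f y by rewrite /phi scale0r add0r.
have [c0|c0] := leP 0 c.
  have [z /[!in_itv]/= /andP[z0 zc]] := MVT_segment c0 (fun t _ => dP t) (cP _).
  rewrite phi0 subr0 => e; exists z; last by rewrite mulrC.
  by rewrite !ger0_norm// (le_trans z0).
have [z /[!in_itv]/= /andP[z0 zc]] := MVT_segment (ltW c0) (fun t _ => dP t) (cP _).
rewrite phi0 sub0r => e; exists z.
  by rewrite !ler0_norm ?lerN2// ltW.
by apply: oppr_inj; rewrite opprB -/(phi c) e mulrN mulrC.
Qed.

(** The increment along h (a u + v) is split at x + h v. The part along v converges by definition;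
    the part along u is h a times the derivative at an intermediate point, which tends to x. *)
Lemma is_deriveDl (f : V -> R) (a : R) (u v x : V) :
  (forall x v, derivable f x v) -> {for x, continuous ('D_u f)} ->
  is_derive x (a *: u + v) f (a * 'D_u f x + 'D_v f x).
Proof.
move=> df cu.
have /choice[z zP] (h : R) : exists z : R, `|z| <= `|h * a| /\
    f ((h * a) *: u + (h *: v + x)) - f (h *: v + x) =
    h * a * 'D_u f (z *: u + (h *: v + x)).
  by have [z ? ?] := @mean_value f u (h *: v + x) (h * a) (fun x => df x u); exists z.
have lim : h^-1 *: ((f \o shift x) (h *: (a *: u + v)) - f x) @[h --> 0^'] -->
    a * 'D_u f x + 'D_v f x.
  have c1 : a * 'D_u f (z h *: u + (h *: v + x)) @[h --> 0^'] --> a * 'D_u f x.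
    have h0 : (h : R) @[h --> 0^'] --> (0 : R).
      exact: nbhs_dnbhs.
    have z0 : z h @[h --> 0^'] --> (0 : R).
      apply/norm_cvg0P; apply: (@squeeze_cvgr _ _ _ _ (fun=> 0) (fun h => `|h * a|)).
      - by near=> h; rewrite normr_ge0 (zP h).1.
      - exact: cvg_cst.
      - rewrite -[X in _ --> X](normr0 R) -[X in `|X|](mul0r a).
        by apply: cvg_norm; apply: cvgMl.
    apply: cvgM; first exact: cvg_cst.
    apply: (continuous_cvg _ cu).
    rewrite -[X in _ --> X]add0r -[X in X + _](scale0r u) -[X in _ + X]add0r -[X in _ + (X + _)](scale0r v).
    apply: cvgD; first exact: cvgZr_tmp.
    by apply: cvgD; [exact: cvgZr_tmp|exact: cvg_cst].
  have c2 : h^-1 *: ((f \o shift x) (h *: v) - f x) @[h --> 0^'] --> 'D_v f x.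
    exact: df.
  apply: cvg_trans (cvgD c1 c2); apply: near_eq_cvg; near=> h => /=.
  have hn0 : h != 0 by near: h; exact: nbhs_dnbhs_neq.
  have := (zP h).2 => e.
  rewrite -[LHS]/(a * _ + h^-1 * (f (h *: v + x) - f x)) -[RHS]/(h^-1 * _).
  rewrite scalerDr scalerA -addrA -[f _ - f x in RHS](subrKA (f (h *: v + x))) [RHS]mulrDr e.
  by congr (_ + _); rewrite -[h * a * _]mulrA mulKf.
apply: DeriveDef; first by apply: cvgP lim.
exact: cvg_lim lim.
Unshelve. all: by end_near. Qed.

End DirectionalDerivative.

Section CountableImage.
Variable R : realType.

(** Otherwise the intermediate value theorem puts a nondegenerate interval into the range, but
    countable sets have Lebesgue measure 0. *)
Lemma countable_image_line (f : R -> R) : continuous f -> countable (range f) ->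
  f 0 = f 1.
Proof.
move=> cf countf; apply: contrapT => /eqP f01.
have sub : `[Num.min (f 0) (f 1), Num.max (f 0) (f 1)]%classic `<=` range f.
  move=> y /= /[!in_itv]/= yf.
  have [||c _ <-] := @IVT R f 0 1 y ler01; last by exists c.
    by apply: continuous_subspaceT.
  by move: yf.
have := countable_lebesgue_measure0 (sub_countable (subset_card_le sub) countf).
rewrite lebesgue_measure_itv /= lte_fin.
have lt : Num.min (f 0) (f 1) < Num.max (f 0) (f 1).
  by rewrite gt_min !lt_max !ltxx /= orbF; case: ltgtP f01.
rewrite lt => /eqP; rewrite -EFinB eqe subr_eq0 => /eqP e.
by rewrite e ltxx in lt.
Qed.

Lemma countable_image_const m (f : 'rV[R]_m -> R) : continuous f ->
  countable (range f) -> forall x y, f x = f y.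
Proof.
move=> cf countf x y; pose g (t : R) := f (t *: (y - x) + x).
have := @countable_image_line g; rewrite /g scale0r add0r scale1r subrK; apply.
  move=> t; apply: continuous_comp; last exact: cf.
  by apply: cvgD; [apply: cvgZr_tmp; exact: cvg_id|exact: cvg_cst].
apply: sub_countable countf; apply: subset_card_le => _ [t _ <-].
by exists (t *: (y - x) + x).
Qed.

End CountableImage.

Section SmoothDerivative.
Variables (R : realType) (m : nat).
Notation V := 'rV[R]_m.

Lemma smooth_derivable (W : normedModType R) (f : V -> W) :
  smooth f -> forall x v, derivable f x v.
Proof. by move=> /smoothP[]. Qed.

Lemma smooth_continuous (W : normedModType R) (f : V -> W) :
  smooth f -> continuous f.
Proof. by move=> /smoothP[]. Qed.

(** Ck only provides directional derivatives: their additivity in the direction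
    comes from the mean value theorem and the continuity of 'D_u phi. *)
Lemma derive_linear p q (phi : V -> 'M[R]_(p, q)) x a u v : smooth phi ->
  'D_(a *: u + v) phi x = a *: 'D_u phi x + 'D_v phi x.
Proof.
move=> /smoothP[_ dphi Dphi].
have dij i j y w : derivable (fun y => phi y i j) y w.
  by have /derivable_mxP := dphi y w; apply.
have H i j : is_derive x (a *: u + v) (fun y => phi y i j)
    (a * 'D_u (fun y => phi y i j) x + 'D_v (fun y => phi y i j) x).
  apply: is_deriveDl => [y w|]; first exact: dij.
  have e : 'D_u (fun y => phi y i j) = (fun M : 'M[R]_(p, q) => M i j) \o (fun y => 'D_u phi y).
    by apply/funext => y /=; rewrite derive_mx// mxE.
  rewrite e; apply: continuous_comp; last exact: coord_continuous.
  exact: (smooth_continuous (Dphi u)).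
rewrite !derive_mx//; apply/matrixP => i j; rewrite !mxE; exact: derive_val.
Qed.

Lemma derive_sum_partial p q (phi : V -> 'M[R]_(p, q)) x u : smooth phi ->
  'D_u phi x = \sum_a u 0 a *: partial a phi x.
Proof.
move=> sphi; rewrite {1}(row_sum_delta u).
have D0 : 'D_0 phi x = 0 by exact: derive0.
by apply: (big_rec2 (fun v y => 'D_v phi x = y)) => // i v y _ <-; rewrite derive_linear.
Qed.

End SmoothDerivative.

Section ClosedSubspace.
Variables (R : realType) (p q : nat) (w : {vspace 'M[R]_(p, q)}).

Lemma closed_vspace : closed [set M | M \in w].
Proof.
pose f : {linear 'M[R]_(p, q) -> 'M[R]_(p, q)} := (\1 - projv w)%VF.
have fE M : (M \in w) = (f M == 0).
  rewrite /f /= add_lfunE opp_lfunE id_lfunE subr_eq0; apply/idP/eqP => [wM|->].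
    by rewrite projv_id.
  exact: memv_proj.
rewrite (_ : [set M | M \in w] = f @^-1` [set 0]).
  apply: preimage_closed; last first.
    exact/accessible_closed_set1/hausdorff_accessible/norm_hausdorff.
  by move=> M _; apply: linear_mx_continuous.
by apply/seteqP; split=> M /=; rewrite fE => /eqP.
Qed.

End ClosedSubspace.

Lemma horner_alg_continuous (R : realType) n (p : {poly R}) :
  continuous (fun z : 'M[R]_n.+1 => horner_alg z p).
Proof.
elim/poly_ind: p => [|p c IH].
  by under eq_fun do rewrite rmorph0; exact: cst_continuous.
under eq_fun do rewrite rmorphD rmorphM /= horner_algX horner_algC.
move=> z; apply: (@cvgD _ _ _ _ (nbhs_filter z)); last exact: cvg_cst.
by apply: cvg_mulmx; [exact: IH|exact: cvg_id].
Qed.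

Lemma nlog_continuous (R : realType) n k :
  continuous (fun z : 'M[R]_n.+1 => nlog k z).
Proof.
move=> z; suff : {for z, continuous
  ((fun y : 'M[R]_n.+1 => horner_alg y (log_poly R k.+1)) \o (fun y => y - 1))} by [].
apply: continuous_comp; last exact: horner_alg_continuous.
by apply: (@cvgB _ _ _ _ (nbhs_filter z)); [exact: cvg_id|exact: cvg_cst].
Qed.

(** If Q M(hu + x) = 1 + h E(h), then h^-1 log(1 + h E(h)) tends to lim E. The index
    k.+1 makes sure that the truncation of log keeps its linear term. *)
Lemma log_derivative_mem (R : realType) (V : normedModType R) n k
    (w : {vspace 'M[R]_n.+1}) (M : V -> 'M[R]_n.+1) (Q : 'M[R]_n.+1) x u :
  derivable M x u -> Q * M x = 1 -> (forall y, nlog k.+1 (Q * M y) \in w) ->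
  Q * 'D_u M x \in w.
Proof.
move=> dM QM Mw.
(* [r] is log(1 + X) / X, so that log(1 + h E) = h r(h E) E with r(0) = 1. *)
pose r : {poly R} := drop_poly 1 (log_poly R k.+2).
have lE : log_poly R k.+2 = r * 'X.
  rewrite -[LHS](poly_take_drop 1) expr1 -[RHS]add0r; congr (_ + _).
  apply/polyP => i; rewrite coef_take_poly coef0; case: i => [|i]//=.
  by rewrite log_poly0.
pose E (h : R) := h^-1 *: (M (h *: u + x) - M x).
have EM : E h @[h --> 0^'] --> 'D_u M x by exact: dM.
have QE : Q * E h @[h --> 0^'] --> Q * 'D_u M x.
  by apply: cvg_mulmx EM; exact: cvg_cst.
have dE h : h != 0 -> Q * M (h *: u + x) - 1 = h *: (Q * E h).
  by move=> h0; rewrite /E -scalerAr scalerA mulfV// scale1r mulrBr QM.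
have QM1 : h *: (Q * E h) @[h --> 0^'] --> (0 : 'M[R]_n.+1).
  rewrite -[X in _ --> X](scale0r (Q * 'D_u M x)); apply: cvgZ => //.
  exact: nbhs_dnbhs.
have rE : horner_alg (h *: (Q * E h)) r @[h --> 0^'] --> (1 : 'M[R]_n.+1).
  have -> : (1 : 'M[R]_n.+1) = horner_alg 0 r.
    by rewrite horner_alg0 coef_drop_poly coef_poly /= expr0 divr1 scale1r.
  exact: (continuous_cvg _ (@horner_alg_continuous R n r 0)).
have lim : horner_alg (h *: (Q * E h)) r * (Q * E h) @[h --> 0^'] --> Q * 'D_u M x.
  by rewrite -[X in _ --> X]mul1r; apply: cvg_mulmx.
apply: (closed_cvg _ (closed_vspace (w := w)) _ _ lim); near=> h.
have h0 : h != 0 by near: h; exact: nbhs_dnbhs_neq.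
have := Mw (h *: u + x); rewrite /nlog lE dE// rmorphM /= horner_algX -scalerAr.
by move=> /(memvZ h^-1); rewrite scalerA mulVf// scale1r.
Unshelve. all: by end_near. Qed.

(** Applied to the logarithm, this makes the exponential charts immersions: a direction killed by
    the derivative of exp is killed by that of log o exp, which is linear in the chart. *)
Lemma derive_horner_eq0 (R : realType) l n (F : 'rV[R]_l -> 'M[R]_n.+1)
    (p : {poly R}) x u :
  smooth F -> 'D_u F x = 0 -> 'D_u (fun y => horner_alg (F y) p) x = 0.
Proof.
move=> sF F0; elim/poly_ind: p => [|p c IH].
  by under eq_fun do rewrite rmorph0; exact: derive_cst.
under eq_fun do rewrite rmorphD rmorphM /= horner_algX horner_algC.
have dF : derivable F x u by exact: smooth_derivable.
have dp : derivable (fun y => horner_alg (F y) p) x u.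
  exact/smooth_derivable/smooth_horner.
have [h1 h2] := is_derive_mulmx dp dF.
have -> : 'D_u (fun y => horner_alg (F y) p * F y + c%:A) x =
    'D_u (fun y => horner_alg (F y) p *m F y) x + 'D_u (fun _ => c%:A : 'M[R]_n.+1) x.
  by apply: deriveD; [exact: h1|exact: derivable_cst].
by rewrite derive_cst addr0 h2 IH F0 mul0mx mulmx0 addr0.
Qed.

(** * The Lie algebra of the Iwasawa group *)

Section LieAlgebra.
Variables (R : realType) (n : nat) (g : lie_algebra R n.+1).
Notation A := 'M[R]_n.+1.
Implicit Types X Y Z H : 'cV[R]_n.+1.

Lemma bracketDr X Y Z : g X (Y + Z) = g X Y + g X Z.
Proof. by have := bracket_linear g X 1 Y Z; rewrite !scale1r. Qed.

Lemma bracket0r X : g X 0 = 0.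
Proof. by have := bracket_linear g X (-1) 0 0; rewrite addr0 scaler0 scaleN1r addNr. Qed.

Lemma bracketZr X c Y : g X (c *: Y) = c *: g X Y.
Proof. by have := bracket_linear g X c Y 0; rewrite !addr0 bracket0r addr0. Qed.

Lemma bracketDl X Y Z : g (Y + Z) X = g Y X + g Z X.
Proof. by rewrite bracket_anti bracketDr opprD -!bracket_anti. Qed.

Lemma bracketZl X c Y : g (c *: Y) X = c *: g Y X.
Proof. by rewrite bracket_anti bracketZr -scalerN -bracket_anti. Qed.

Lemma bracket_sumr X (I : Type) (r : seq I) (F : I -> 'cV[R]_n.+1) :
  g X (\sum_(i <- r) F i) = \sum_(i <- r) g X (F i).
Proof.
by apply: (big_morph (g X)); [exact: bracketDr|exact: bracket0r].
Qed.

Lemma bracket_suml X (I : Type) (r : seq I) (F : I -> 'cV[R]_n.+1) :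
  g (\sum_(i <- r) F i) X = \sum_(i <- r) g (F i) X.
Proof.
rewrite bracket_anti bracket_sumr -sumrN; apply: eq_bigr => i _.
by rewrite -bracket_anti.
Qed.

Lemma ad_mul X Y : ad g X *m Y = g X Y.
Proof.
rewrite {2}[Y]matrix_sum_delta bracket_sumr; apply/matrixP => i j.
rewrite (ord1 j) mxE summxE; apply: eq_bigr => l _.
by rewrite big_ord1 bracketZr !mxE mulrC.
Qed.

Lemma eq_mulmx_col (M N : A) : (forall Y : 'cV[R]_n.+1, M *m Y = N *m Y) -> M = N.
Proof.
move=> MN; apply/matrixP => i j; have /matrixP/(_ i 0) := MN (delta_mx j 0).
have e (L : A) : (L *m (delta_mx j 0 : 'cV_n.+1)) i 0 = L i j.
  by rewrite -colE mxE.
by rewrite !e.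
Qed.

Lemma ad_is_linear : linear (ad g).
Proof.
move=> c X Y; apply: eq_mulmx_col => Z.
by rewrite mulmxDl -scalemxAl !ad_mul bracketDl bracketZl.
Qed.

HB.instance Definition _ := GRing.isLinear.Build R 'cV[R]_n.+1 A *:%R (ad g) ad_is_linear.

Lemma linfun_ad X : linfun (ad g) X = ad g X.
Proof. exact: lfunE. Qed.

Lemma ad_bracket X Y : ad g (g X Y) = ad g X * ad g Y - ad g Y * ad g X.
Proof.
apply: eq_mulmx_col => Z; rewrite mulmxBl -!mulmxA !ad_mul.
have := bracket_jacobi g X Y Z.
rewrite (bracket_anti g Z (g X Y)) (bracket_anti g Z X) -[- g X Z]scaleN1r bracketZr scaleN1r.
by move=> /eqP; rewrite subr_eq0 => /eqP.
Qed.

Section Involution.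
Variables (theta : A) (hth : cartan_involution g theta).

Lemma thetaK : theta * theta = 1. Proof. by case: hth. Qed.

Lemma ad_theta X : ad g (theta *m X) = theta * ad g X * theta.
Proof.
apply: eq_mulmx_col => Z; rewrite -!mulmxA !ad_mul; case: hth => th2 thg _.
by rewrite thg mulmxA th2 mul1mx.
Qed.

Lemma killingC X Y : killing g X Y = killing g Y X.
Proof. exact: mxtrace_mulC. Qed.

Lemma killing_theta X Y : killing g (theta *m X) (theta *m Y) = killing g X Y.
Proof.
rewrite /killing !ad_theta -[_ *m _]/(_ * _) !mulrA.
rewrite -[_ * theta * theta]mulrA thetaK mulr1 -[_ * theta]/(_ *m _) mxtrace_mulC.
by rewrite -[_ *m _]/(_ * _) !mulrA thetaK mul1r.
Qed.

Lemma BthetaC X Y : Btheta g theta X Y = Btheta g theta Y X.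
Proof.
rewrite /Btheta -killing_theta mulmxA.
by case: hth => -> _ _; rewrite mul1mx killingC.
Qed.

Lemma Btheta_linl c X Y Z :
  Btheta g theta (c *: X + Y) Z = c * Btheta g theta X Z + Btheta g theta Y Z.
Proof.
by rewrite /Btheta /killing ad_is_linear mulmxDl -scalemxAl mxtraceD mxtraceZ opprD mulrN.
Qed.

End Involution.

(** * Positive weights force nilpotency *)

Section Weights.
Variable D : A.

Definition weight_vec (c : R) (Y : A) := D * Y - Y * D = c *: Y.

Lemma weight_mul c c' (Y Y' : A) :
  weight_vec c Y -> weight_vec c' Y' -> weight_vec (c + c') (Y * Y').
Proof.
rewrite /weight_vec => h h'.
rewrite scalerDl scalerAl -h scalerAr -h' mulrBl mulrBr !mulrA.
by rewrite addrA subrK.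
Qed.

(** The eigenvalues of ad D are bounded by twice the sum of the |D i j|. *)
Lemma weight_bound : exists C : R, forall c (Y : A), weight_vec c Y -> C < c -> Y = 0.
Proof.
pose C := \sum_i \sum_j `|D i j| + \sum_i \sum_j `|D i j|.
exists C => c W DW Cc.
have C0 : 0 <= C by rewrite addr_ge0// sumr_ge0// => i _; rewrite sumr_ge0.
(* The equation D W - W D = c W is compared at an entry of W of largest modulus. *)
pose p := [arg max_(p > (ord0, ord0) : 'I_n.+1 * 'I_n.+1) `|W p.1 p.2|]%O.
have pmax i j : `|W i j| <= `|W p.1 p.2|.
  by rewrite /p; case: arg_maxP => // q _ /(_ (i, j)); apply.
suff W0 : W p.1 p.2 = 0.
  by apply/matrixP => i j; rewrite mxE; apply/eqP; rewrite -normr_le0 (le_trans (pmax i j))// W0 normr0.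
have rowD i : \sum_j `|D i j| <= \sum_i \sum_j `|D i j|.
  by rewrite [leRHS](bigD1 i)//= lerDl sumr_ge0// => ? _; rewrite sumr_ge0.
have colD j : \sum_i `|D i j| <= \sum_i \sum_j `|D i j|.
  rewrite exchange_big [leRHS](bigD1 j)//= lerDl sumr_ge0// => ? _.
  by rewrite sumr_ge0.
have := congr1 (fun M : A => `|M p.1 p.2|) DW; rewrite !mxE normrM.
move=> e; apply/eqP; rewrite -normr_le0 leNgt; apply/negP => W0.
have : `|c| * `|W p.1 p.2| <= C * `|W p.1 p.2|.
  rewrite -e (le_trans (ler_normB _ _))// mulrDl lerD//.
    apply: le_trans (ler_norm_sum _ _ _) _.
    apply: le_trans (ler_wpM2r (normr_ge0 _) (rowD p.1)).
    by rewrite mulr_suml ler_sum// => l _; rewrite normrM ler_wpM2l.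
  apply: le_trans (ler_norm_sum _ _ _) _.
  apply: le_trans (ler_wpM2r (normr_ge0 _) (colD p.2)).
  by rewrite mulr_suml ler_sum// => l _; rewrite normrM mulrC ler_wpM2l.
by rewrite ler_pM2r// leNgt (lt_le_trans Cc)// ler_norm.
Qed.

(** The finitely many weights have a common lower bound e > 0, and weights add up along products, so
    a word of length K has weight at least K e, beyond the bound of [weight_bound]. *)
Lemma positive_weights_nil (T : seq A) :
  (forall Y : A, Y \in T -> exists2 c, 0 < c & weight_vec c Y) ->
  exists K, forall l : seq A, (forall Y : A, Y \in l -> Y \in T) -> (K <= size l)%N ->
    \prod_(Y <- l) Y = 0.
Proof.
move=> Tw.
have [e e0 Te] : exists2 e : R, 0 < e &
    forall Y : A, Y \in T -> exists2 c, e <= c & weight_vec c Y.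
  elim: T Tw => [|Y T IH] Tw; first by exists 1.
  have [|e e0 Te] := IH; first by move=> Z ZT; apply: Tw; rewrite inE ZT orbT.
  have [|c c0 Yc] := Tw Y; first by rewrite inE eqxx.
  exists (Num.min e c) => [|Z]; first by rewrite lt_min e0.
  rewrite inE => /predU1P[->|/Te[c' ec' Zc']].
    by exists c; rewrite // ge_min lexx orbT.
  by exists c'; rewrite // ge_min ec'.
have [C CP] := weight_bound.
have [K CK] : exists K : nat, C < K%:R * e.
  exists (Num.trunc (Num.max 0 (C / e))).+1.
  rewrite -ltr_pdivrMr// (le_lt_trans (y := Num.max 0 (C / e)))//.
    by rewrite le_max lexx orbT.
  exact: truncnS_gt.
exists K => l lT Kl.
have [c lc wc] : exists2 c, (size l)%:R * e <= c & weight_vec c (\prod_(Y <- l) Y).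
  elim: l lT {Kl} => [|Y l IH] lT.
    exists 0; first by rewrite mul0r.
    by rewrite big_nil /weight_vec mulr1 mul1r subrr scale0r.
  have [|c lc wc] := IH; first by move=> Z Zl; apply: lT; rewrite inE Zl orbT.
  have [|c' ec' wc'] := Te Y; first by apply: lT; rewrite inE eqxx.
  exists (c' + c); last by rewrite big_cons; apply: weight_mul.
  by rewrite /= -natr1 mulrDl mul1r addrC lerD.
apply: CP wc _; apply: lt_le_trans CK _; apply: le_trans lc.
by rewrite ler_pM2r// ler_nat.
Qed.

End Weights.

(** Since [raising] is stable under linear combinations, it replaces the multilinear expansion of
    words over [v] into words over [T]. *)
Lemma span_words_nil (T : seq A) (v : {vspace A}) K : (v <= <<T>>)%VS ->
  (forall l : seq A, (forall Y : A, Y \in l -> Y \in T) -> (K <= size l)%N ->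
    \prod_(Y <- l) Y = 0) ->
  forall l : seq A, (forall Y : A, Y \in l -> Y \in v) -> (K <= size l)%N ->
    \prod_(Y <- l) Y = 0.
Proof.
move=> vT TK l lv Kl.
have rais (Y : A) : Y \in v -> raising (fun P => P \in T) K Y.
  move=> /(subvP vT) YT; rewrite (coord_span (X := in_tuple T) YT); apply: raising_sum => i _; apply: raisingZ.
  by apply: raising_gen; rewrite mem_nth.
have k1 : kills (fun P : A => P \in T) K 0 1.
  by move=> l' l'T Kl'; rewrite TK// mulr0.
suff kl : forall j b, kills (fun P : A => P \in T) K j b ->
    kills (fun P : A => P \in T) K (j + size l) (b * \prod_(Y <- l) Y).
  by have := kl 0 1 k1 [::]; rewrite big_nil mulr1 mul1r addn0; apply.
elim: l lv {Kl} => [|Y l IH] lv j b kb; first by rewrite addn0 big_nil mulr1.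
rewrite big_cons mulrA /= addnS -addSn; apply: IH.
  by move=> Z Zl; apply: lv; rewrite inE Zl orbT.
by apply: rais => //; apply: lv; rewrite inE eqxx.
Qed.

Section Iwasawa.
Variables (a : {vspace 'cV[R]_n.+1}) (Sigma_pos : set ('cV[R]_n.+1 -> R)).
Hypothesis hSigma : positive_roots g a Sigma_pos.
Variable nn : {vspace 'cV[R]_n.+1}.
Hypothesis hn : sum_of_root_spaces g a Sigma_pos nn.

Lemma root_vec_mem lambda X : Sigma_pos lambda -> root_space g a lambda X -> X \in nn.
Proof.
move=> sl lX; apply/hn; exists [:: X]; last by rewrite big_seq1.
by move=> Y; rewrite inE => /eqP ->; exists lambda.
Qed.

Lemma iwasawa_bracket X Y : X \in nn -> Y \in nn -> g X Y \in nn.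
Proof.
move=> /hn[t tP ->] /hn[t' t'P ->].
rewrite bracket_suml big_seq; apply: memv_suml => U /tP[l sl lU].
rewrite bracket_sumr big_seq; apply: memv_suml => W /t'P[m sm mW].
have [H0 [aH0 H0r] pos] := hSigma.
have lmW : root_space g a (fun H => l H + m H) (g U W).
  move=> H aH; have := bracket_jacobi g H U W.
  rewrite (bracket_anti g W H) (mW _ aH) (bracket_anti g W (g H U)) (lU _ aH).
  rewrite -scaleNr bracketZr bracketZl => /eqP; rewrite subr_eq0 scaleNr => /eqP e.
  by apply/eqP; rewrite scalerDl -subr_eq -e.
have [->|gn0] := eqVneq (g U W) 0; first by rewrite mem0v.
have [[_ l0] [_ m0]] := (iffLR (pos l) sl, iffLR (pos m) sm).
apply: (root_vec_mem _ lmW); apply/pos; split; last exact: addr_gt0.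
split; last by exists (g U W).
by exists H0; rewrite // gt_eqF// addr_gt0.
Qed.

Definition lie_n : {vspace A} := (linfun (ad g) @: nn)%VS.

Lemma lie_nP P : reflect (exists2 X, X \in nn & P = ad g X) (P \in lie_n).
Proof.
apply: (iffP idP) => [/memv_imgP[X nX ->]|[X nX ->]].
  by exists X; rewrite // linfun_ad.
by rewrite -linfun_ad memv_img.
Qed.

Lemma lie_n_commutator P Q : P \in lie_n -> Q \in lie_n -> P * Q - Q * P \in lie_n.
Proof.
move=> /lie_nP[X nX ->] /lie_nP[Y nY ->]; rewrite -ad_bracket.
by apply/lie_nP; exists (g X Y); rewrite // iwasawa_bracket.
Qed.

Lemma lie_n_nil : exists K, forall l : seq A, (forall Y : A, Y \in l -> Y \in lie_n) ->
  (K <= size l)%N -> \prod_(Y <- l) Y = 0.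
Proof.
have [H0 [aH0 H0r] pos] := hSigma.
(* A finite spanning family of root vectors, collected over a basis of [nn], provides the finitely
   many weights required by [positive_weights_nil]. *)
have [T Tw Tspan] : exists2 T : seq 'cV[R]_n.+1,
    (forall Y, Y \in T -> exists2 l, Sigma_pos l & root_space g a l Y) &
    (nn <= <<T>>)%VS.
  suff [T Tw TP] : exists2 T : seq 'cV[R]_n.+1,
    (forall Y, Y \in T -> exists2 l, Sigma_pos l & root_space g a l Y) &
    (forall X, X \in (vbasis nn : seq _) -> X \in <<T>>%VS).
    by exists T => //; rewrite -(span_basis (vbasisP nn)); apply/span_subvP.
  have : forall X, X \in (vbasis nn : seq _) -> X \in nn by move=> X; exact: (@vbasis_mem _ _ X nn).
  elim: (vbasis nn : seq _) => [|X s IH] sn; first by exists [::].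
  have [|T Tw TP] := IH; first by move=> Y Ys; apply: sn; rewrite inE Ys orbT.
  have /hn[t tP Xt] : X \in nn by apply: sn; rewrite inE eqxx.
  exists (t ++ T) => Y.
    by rewrite mem_cat => /orP[/tP|/Tw].
  rewrite inE span_cat => /predU1P[->|/TP YT].
    rewrite Xt; apply: (subvP (addvSl _ _)).
    by rewrite big_seq; apply: memv_suml => Z Zt; apply: memv_span.
  exact: (subvP (addvSr _ _)).
pose T' := map (ad g) T.
have [|K KP] := @positive_weights_nil (ad g H0) T'.
  move=> _ /mapP[Y /Tw[l sl lY] ->]; exists (l H0); first by have [] := iffLR (pos l) sl.
  by rewrite /weight_vec -ad_bracket lY// linearZ.
exists K; apply: span_words_nil KP; apply/subvP => P /lie_nP[X /(subvP Tspan) XT ->].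
rewrite (coord_span (X := in_tuple T) XT) linear_sum; apply: memv_suml => i _; rewrite linearZ memvZ//.
by apply/memv_span/map_f/mem_nth.
Qed.

End Iwasawa.

End LieAlgebra.

(** * The group N and its subgroup S *)

Section ExpLog.
Variables (R : realType) (n k : nat).
Notation A := 'M[R]_n.+1.

Lemma expm_nilpotent (P : A) : P ^+ k.+1 = 0 -> expm P = nexp k P.
Proof.
move=> Pk; rewrite /expm; apply/cvg_lim; first exact: norm_hausdorff.
apply: cvg_near_cst.
near=> N; rewrite /series /= nexpE.
have kN : (k.+1 <= N)%N by near: N; exists k.+1.
rewrite (big_cat_nat (n := k.+1))//= big_mkord -[RHS]addr0; congr (_ + _).
rewrite big_nat big1// => i /andP[ki _].
by rewrite -(subnK ki) exprD Pk mulr0 scaler0.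
Unshelve. all: by end_near. Qed.

Lemma nlogK (P : A) : P ^+ k.+1 = 0 -> nlog k (nexp k P) = P.
Proof.
move=> Pk; rewrite /nlog.
have -> : nexp k P - 1 = horner_alg P (exp_poly R k.+1 - 1).
  by rewrite rmorphB rmorph1.
rewrite -horner_alg_comp (eq_upto_horner Pk (log_exp_poly (k := k) (nat_unit_num R))).
by rewrite horner_algX.
Qed.

End ExpLog.

Section ConnectedSubgroup.
Variables (R : realType) (n k : nat).
Notation A := 'M[R]_n.+1.
Variable v : {vspace A}.
Hypothesis vv : forall P Q, P \in v -> Q \in v -> P * Q - Q * P \in v.
Hypothesis vnil : forall l : seq A, (forall P, P \in l -> P \in v) ->
  (k.+1 <= size l)%N -> \prod_(P <- l) P = 0.
Notation ex := (@nexp R A k).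
Notation lg := (@nlog R A k).

Let nilv := nil_v vnil.

Lemma nexpM_unip P Q : P \in v -> Q \in v -> (ex P * ex Q - 1) ^+ k.+1 = 0.
Proof.
move=> vP vQ; apply: (raising_nil (G := fun P => P \in v)).
  exact: (kills_start vnil).
by apply: raising_mul1; apply/raising_nexp/raising_v.
Qed.

Lemma nexpM P Q : P \in v -> Q \in v -> exists2 Z, Z \in v & ex P * ex Q = ex Z.
Proof.
move=> vP vQ; exists (lg (ex P * ex Q)).
  have := bch (subvv v) vv vnil vP vQ.
  by move=> /memvD/(_ (memvD vP vQ)); rewrite subrK.
by rewrite nexpK ?nexpM_unip//; exact: nat_unit_num.
Qed.

Lemma nexp0 : ex 0 = 1.
Proof. by rewrite /nexp horner_alg0 exp_poly0 scale1r. Qed.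

Lemma connected_subgroupP M :
  connected_subgroup v M <-> exists2 P, P \in v & M = ex P.
Proof.
split=> [[t tv ->]|[P vP ->]]; last first.
  exists [:: P]; first by move=> Q; rewrite inE => /eqP ->.
  by rewrite big_seq1 (@expm_nilpotent _ _ k)// nilv.
elim: t tv => [|P t IH] tv.
  by exists 0; rewrite ?mem0v// big_nil nexp0.
have [|Q vQ e] := IH; first by move=> Q Qt; apply: tv; rewrite inE Qt orbT.
have vP : P \in v by apply: tv; rewrite inE eqxx.
have [Z vZ eZ] := nexpM vP vQ.
by exists Z => //; rewrite big_cons e (@expm_nilpotent _ _ k) ?nilv.
Qed.

Lemma nexp_unit P : P \in v -> ex P \in unitmx /\ invmx (ex P) = ex (- P).
Proof.
move=> vP; have e : ex (- P) * ex P = 1.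
  by apply: nexpN; [exact: nat_unit_num|exact: nilv].
have u : ex P \in unitmx by case: (mulmx1_unit e).
by split=> //; rewrite -[RHS]mulmx1 -(mulmxV u) mulmxA [X in X *m _]e mul1mx.
Qed.

Lemma connected_subgroup1 : connected_subgroup v 1%:M.
Proof. by apply/connected_subgroupP; exists 0; rewrite ?mem0v// nexp0. Qed.

Lemma connected_subgroupM p q : connected_subgroup v p -> connected_subgroup v q ->
  connected_subgroup v (p *m q).
Proof.
move=> /connected_subgroupP[P vP ->] /connected_subgroupP[Q vQ ->].
by apply/connected_subgroupP; exact: nexpM.
Qed.

Lemma connected_subgroup_unit p : connected_subgroup v p -> p \in unitmx.
Proof. by move=> /connected_subgroupP[P vP ->]; have [] := nexp_unit vP. Qed.

Lemma connected_subgroupV p : connected_subgroup v p -> connected_subgroup v (invmx p).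
Proof.
move=> /connected_subgroupP[P vP ->]; apply/connected_subgroupP.
by exists (- P); rewrite ?memvN//; have [] := nexp_unit vP.
Qed.

Lemma nlog_mem p : connected_subgroup v p -> lg p \in v.
Proof. by move=> /connected_subgroupP[P vP ->]; rewrite nlogK// nilv. Qed.

Lemma connected_nlogK p : connected_subgroup v p -> ex (lg p) = p.
Proof. by move=> /connected_subgroupP[P vP ->]; rewrite nlogK// nilv. Qed.

Lemma nlogV p : connected_subgroup v p -> lg (invmx p) = - lg p.
Proof.
move=> /connected_subgroupP[P vP ->]; have [_ ->] := nexp_unit vP.
by rewrite !nlogK ?nilv ?memvN.
Qed.

Lemma invmx_nexp p : connected_subgroup v p -> invmx p = ex (- lg p).
Proof.
move=> /connected_subgroupP[P vP ->]; have [_ ->] := nexp_unit vP.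
by rewrite nlogK// nilv.
Qed.

Variable s : {vspace A}.
Hypothesis sv : (s <= v)%VS.
Hypothesis vvs : forall P Q, P \in v -> Q \in v -> P * Q - Q * P \in s.

Lemma nlogM p q : connected_subgroup v p -> connected_subgroup v q ->
  lg (p *m q) - (lg p + lg q) \in s.
Proof.
move=> /connected_subgroupP[P vP ->] /connected_subgroupP[Q vQ ->].
by rewrite !nlogK ?nilv//; exact: (bch sv vvs vnil vP vQ).
Qed.

Lemma nlogVM p q : connected_subgroup v p -> connected_subgroup v q ->
  lg (invmx p *m q) - (lg q - lg p) \in s.
Proof.
move=> vp vq; have := nlogM (connected_subgroupV vp) vq.
by rewrite nlogV// [- _ + _]addrC.
Qed.

End ConnectedSubgroup.

Section Subgroup.
Variables (R : realType) (n k : nat).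
Notation A := 'M[R]_n.+1.
Variables v s : {vspace A}.
Hypothesis sv : (s <= v)%VS.
Hypothesis vvs : forall P Q, P \in v -> Q \in v -> P * Q - Q * P \in s.
Hypothesis vnil : forall l : seq A, (forall P, P \in l -> P \in v) ->
  (k.+2 <= size l)%N -> \prod_(P <- l) P = 0.
Notation ex := (@nexp R A k.+1).
Notation lg := (@nlog R A k.+1).
Notation NN := (connected_subgroup v).
Notation S0 := (connected_subgroup s).

Lemma ambient_bracket P Q : P \in v -> Q \in v -> P * Q - Q * P \in v.
Proof. by move=> vP vQ; apply: (subvP sv); apply: vvs. Qed.

Lemma ideal_bracket P Q : P \in s -> Q \in s -> P * Q - Q * P \in s.
Proof. by move=> /(subvP sv) vP /(subvP sv) vQ; apply: vvs. Qed.

Lemma ideal_words_nil (l : seq A) : (forall P, P \in l -> P \in s) ->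
  (k.+2 <= size l)%N -> \prod_(P <- l) P = 0.
Proof. by move=> ls; apply: vnil => P /ls/(subvP sv). Qed.

Lemma nlog_S0 p : NN p -> lg p \in s -> S0 p.
Proof.
move=> vp sp; apply/(connected_subgroupP ideal_bracket ideal_words_nil); exists (lg p) => //.
by rewrite (connected_nlogK ambient_bracket vnil).
Qed.

Lemma S0_nlog p : S0 p -> lg p \in s.
Proof. exact: (nlog_mem ideal_bracket ideal_words_nil). Qed.

Variables (S : set A).
Hypothesis SN : S `<=` NN.
Hypothesis S1 : S 1%:M.
Hypothesis SM : forall p q, S p -> S q -> S (p *m q).
Hypothesis SV : forall p, S p -> S (invmx p).
Hypothesis S0S : S0 `<=` S.

Let N1 := connected_subgroup1 ambient_bracket vnil.
Let NM := connected_subgroupM ambient_bracket vnil.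
Let NV := connected_subgroupV ambient_bracket vnil.
Let Nu := connected_subgroup_unit ambient_bracket vnil.

(** Normality of [S0] would not be enough for a disconnected [S]. Instead the group commutator of p
    and q lies in [S0], because log is additive modulo [s] and so cancels on commutators. *)
Lemma subgroup_normal p q : NN p -> S q -> S (p *m q *m invmx p).
Proof.
move=> Np Sq; have Nq := SN Sq.
have -> : p *m q *m invmx p = p *m q *m invmx p *m invmx q *m q.
  by rewrite mulmxKV// Nu.
apply: SM => //; apply: S0S; apply: nlog_S0.
  by do !apply: NM => //; apply: NV.
have h1 := nlogM ambient_bracket vnil sv vvs (NM (NM Np Nq) (NV Np)) (NV Nq).
have h2 := nlogM ambient_bracket vnil sv vvs (NM Np Nq) (NV Np).
have h3 := nlogM ambient_bracket vnil sv vvs Np Nq.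
rewrite (nlogV ambient_bracket vnil) // in h1; rewrite (nlogV ambient_bracket vnil)// in h2.
have := memvD h1 (memvD h2 h3).
set x := lg (_ *m _ *m _ *m _); set y := lg (_ *m _ *m _); set z := lg (_ *m _).
suff -> : x - (y - lg q) + (y - (z - lg p) + (z - (lg p + lg q))) = x by [].
rewrite !opprB !opprD !addrA.
by rewrite !subrK !addrK.
Qed.

Variable c : nat -> A.
Hypothesis Sc : S `<=` \bigcup_i coset (c i) S0.

(** [lie_subgroup] does not require its representatives to lie in [S]; those whose coset meets [S]
    do. *)
Lemma component_rep i p : S p -> coset (c i) S0 p -> S (c i).
Proof.
move=> Sp [q S0q e]; have Sq := S0S S0q.
have -> : c i = p *m invmx q by rewrite -e mulmxK// Nu//; apply: SN.
by apply: SM => //; apply: SV.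
Qed.

(** S may have countably many components, even dense ones: phi stays in one of
    them because the class of lg (phi x) modulo s takes countably many values and
    is continuous. *)
Lemma nlog_constant_class m (phi : 'rV[R]_m -> A) : continuous phi -> (forall x, S (phi x)) ->
  forall x y, lg (phi y) - lg (phi x) \in s.
Proof.
move=> cphi Sphi x y.
pose f : {linear A -> A} := (\1 - projv s)%VF.
have fE M : (M \in s) = (f M == 0).
  rewrite /f /= add_lfunE opp_lfunE id_lfunE subr_eq0; apply/idP/eqP => [wM|->].
    by rewrite projv_id.
  exact: memv_proj.
rewrite fE linearB subr_eq0; apply/eqP/matrixP => i j.
apply: (@countable_image_const _ _ (fun x => f (lg (phi x)) i j)).
  move=> z; apply: (continuous_comp (f := fun z => f (lg (phi z)))
    (g := fun M : A => M i j)); last exact: coord_continuous.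
  apply: (continuous_comp (f := fun z => lg (phi z)) (g := f)); last first.
    exact: linear_mx_continuous.
  apply: (continuous_comp (f := phi) (g := lg)); first exact: cphi.
  exact: nlog_continuous.
apply: (@sub_countable _ _ _ (range (fun l => f (lg (c l)) i j))); last first.
  exact: card_image_le.
apply: subset_card_le => _ [z _ <-].
have [l _ cl] := Sc (Sphi z); exists l => //.
have Scl := component_rep (Sphi z) cl.
have [q S0q e] := cl.
have h := nlogM ambient_bracket vnil sv vvs (SN Scl) (SN (S0S S0q)).
have {h} : lg (phi z) - lg (c l) \in s.
  rewrite -e; have := memvD h (S0_nlog S0q).
  by rewrite opprD addrA subrK.
by rewrite fE linearB subr_eq0 => /eqP ->.
Qed.

End Subgroup.

(** * Left cosets of S *)

Lemma derive_mem (R : realType) (V : normedModType R) p q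
    (w : {vspace 'M[R]_(p, q)}) (f : V -> 'M[R]_(p, q)) x u :
  derivable f x u -> (forall y, f y \in w) -> 'D_u f x \in w.
Proof.
move=> df fw; apply: (closed_cvg _ (closed_vspace (w := w)) _ _ df).
by near=> h; rewrite /= memvZ// memvB.
Unshelve. all: by end_near. Qed.

Lemma sum_symmetrize (F : numFieldType) m (G : 'M[F]_m) (h : 'I_m -> 'I_m -> F) :
  G^T = G -> \sum_a \sum_b G a b * h a b = 0 ->
  \sum_a \sum_b G a b * (2^-1 * (h b a + h a b)) = 0.
Proof.
move=> GT h0; have h0' : \sum_a \sum_b G a b * h b a = 0.
  rewrite exchange_big /= -[RHS]h0; apply: eq_bigr => b _; apply: eq_bigr => a _.
  by rewrite -{1}GT mxE.
transitivity (2^-1 * (\sum_a \sum_b G a b * h b a + \sum_a \sum_b G a b * h a b)).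
  rewrite -big_split mulr_sumr; apply: eq_bigr => a _.
  rewrite -big_split mulr_sumr; apply: eq_bigr => b _.
  by rewrite mulrCA mulrDr.
by rewrite h0 h0' addr0 mulr0.
Qed.

Lemma vspace_coordinates (R : realType) p q (s : {vspace 'M[R]_(p, q)}) :
  exists (lin : {linear 'rV[R]_(\dim s) -> 'M[R]_(p, q)})
         (crd : {linear 'M[R]_(p, q) -> 'rV[R]_(\dim s)}),
    [/\ forall x, lin x \in s, cancel lin crd & {in s, cancel crd lin}].
Proof.
pose lin0 (x : 'rV[R]_(\dim s)) := \sum_(a < \dim s) x 0 a *: (vbasis s)`_a.
have linl : linear lin0.
  move=> b x y; rewrite /lin0 scaler_sumr -big_split; apply: eq_bigr => a _ /=.
  by rewrite !mxE scalerDl scalerA.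
pose crd0 (M : 'M[R]_(p, q)) : 'rV[R]_(\dim s) := \row_a coord (vbasis s) a M.
have crdl : linear crd0 by move=> b x y; apply/rowP => a; rewrite !mxE linearP.
pose lin : {linear 'rV[R]_(\dim s) -> 'M[R]_(p, q)} :=
  HB.pack lin0 (GRing.isLinear.Build R _ _ *:%R _ linl).
pose crd : {linear 'M[R]_(p, q) -> 'rV[R]_(\dim s)} :=
  HB.pack crd0 (GRing.isLinear.Build R _ _ *:%R _ crdl).
exists lin, crd; split=> [x|x|M sM] /=.
- by apply: memv_suml => a _; rewrite memvZ// vbasis_mem// mem_nth// size_tuple.
- by apply/rowP => a; rewrite mxE coord_sum_free// (basis_free (vbasisP s)).
- by rewrite [RHS](coord_vbasis sM); apply: eq_bigr => a _; rewrite mxE.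
Qed.

Section Hypersurface.
Variables (R : realType) (n k : nat).
Notation A := 'M[R]_n.+1.
Variable N : metric_group R n.+1.
Notation v := (lie N).
Variables (s : {vspace A}) (S : set A).
Notation m := (\dim s).
Hypothesis hcar : carrier N = connected_subgroup v.
Hypothesis ip_linl : forall c x y z, ip N (c *: x + y) z = c * ip N x z + ip N y z.
Hypothesis ipC : forall x y, ip N x y = ip N y x.
Hypothesis ip_pos : forall x, x \in v -> x != 0 -> 0 < ip N x x.
Hypothesis vvs : forall P Q, P \in v -> Q \in v -> P * Q - Q * P \in s.
Hypothesis vnil : forall l : seq A, (forall P, P \in l -> P \in v) ->
  (k.+2 <= size l)%N -> \prod_(P <- l) P = 0.
Hypothesis hS : lie_subgroup N S s.
Notation ex := (@nexp R A k.+1).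
Notation lg := (@nlog R A k.+1).
Notation S0 := (connected_subgroup s).

Let sv : (s <= v)%VS. Proof. by case: hS => -[]. Qed.
Let svP := subvP sv.
Let vv := ambient_bracket sv vvs.
Let ss := ideal_bracket sv vvs.
Let snil := ideal_words_nil sv vnil.
Let SN : S `<=` carrier N. Proof. by case: hS. Qed.
Let SN' : S `<=` connected_subgroup v. Proof. by rewrite -hcar. Qed.
Let S1 : S 1%:M. Proof. by case: hS => _ _ []. Qed.
Let SM p q : S p -> S q -> S (p *m q). Proof. by case: hS => _ _ [_ h _] _ _; apply: h. Qed.
Let SV p : S p -> S (invmx p). Proof. by case: hS => _ _ [_ _ h] _ _; apply: h. Qed.
Let S0S : S0 `<=` S. Proof. by case: hS. Qed.

Lemma carrierM p q : carrier N p -> carrier N q -> carrier N (p *m q).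
Proof. by rewrite hcar; apply: (connected_subgroupM vv vnil). Qed.

Lemma carrierV p : carrier N p -> carrier N (invmx p).
Proof. by rewrite hcar; apply: (connected_subgroupV vv vnil). Qed.

Lemma carrier_unit p : carrier N p -> p \in unitmx.
Proof. by rewrite hcar; apply: (connected_subgroup_unit vv vnil). Qed.

Lemma carrierK p M : carrier N p -> invmx p *m (p *m M) = M :> A.
Proof. by move=> /carrier_unit pu; rewrite mulKmx. Qed.

Lemma carrierVK p M : carrier N p -> p *m (invmx p *m M) = M :> A.
Proof. by move=> /carrier_unit pu; rewrite mulKVmx. Qed.

Lemma cosetP p q : carrier N p -> coset p S q <-> S (invmx p *m q).
Proof.
move=> Np; split=> [[x Sx <-]|Sq]; first by rewrite carrierK.
by exists (invmx p *m q); rewrite // carrierVK.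
Qed.

Lemma coset_sub p : carrier N p -> coset p S `<=` carrier N.
Proof. by move=> Np _ [q /SN Nq <-]; apply: carrierM. Qed.

Lemma coset_eq p q : carrier N p -> coset p S q -> coset p S = coset q S.
Proof.
move=> Np [x Sx <-]; apply/seteqP; split=> _ [y Sy <-].
  exists (invmx x *m y); first by apply: SM => //; apply: SV.
  by rewrite mulmxA mulmxK//; apply/carrier_unit/SN.
by exists (x *m y); [apply: SM|rewrite mulmxA].
Qed.

(** On [N], inversion is the polynomial map exp(- log p). *)
Lemma smooth_invmx l (phi : 'rV[R]_l -> A) : smooth_into N phi ->
  smooth (fun x => invmx (phi x)).
Proof.
move=> [sphi Nphi].
have -> : (fun x => invmx (phi x)) =
    fun x => horner_alg (- (1 : R) *: horner_alg (phi x - 1) (log_poly R k.+2)) (exp_poly R k.+2).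
  apply/funext => x; rewrite (invmx_nexp vv vnil) -?hcar//.
  by rewrite scaleN1r.
apply: smooth_horner.
have -> : (fun x => - (1 : R) *: horner_alg (phi x - 1) (log_poly R k.+2)) =
   fun x => (- 1%:M) *m horner_alg (phi x + (- 1)) (log_poly R k.+2).
  by apply/funext => x; rewrite mulNmx mul1mx scaleN1r.
apply: smooth_mulmxl; apply: smooth_horner.
by apply: smoothD => //; exact: smooth_cst.
Qed.

Lemma smooth_into_mulmx l p (phi : 'rV[R]_l -> A) : carrier N p ->
  smooth_into N phi -> smooth_into N (fun x => p *m phi x).
Proof.
move=> Np [sphi Nphi]; split; first exact: smooth_mulmxl.
by move=> x; apply: carrierM.
Qed.

Lemma omega_mulmx l p (phi : 'rV[R]_l -> A) : carrier N p ->
  smooth_into N phi -> omega (fun x => p *m phi x) = omega phi.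
Proof.
move=> Np [sphi Nphi]; apply/funext => a; apply/funext => x.
rewrite /omega /partial derive_mulmxl; last exact: smooth_derivable.
have pu := carrier_unit Np; have xu := carrier_unit (Nphi x).
have -> : invmx (p *m phi x) = invmx (phi x) *m invmx p.
  by rewrite -[_ *m _]/(p * phi x) -[invmx _]/(GRing.inv _) invrM.
by rewrite -mulmxA mulKmx.
Qed.

Lemma induced_metric_mulmx l p (phi : 'rV[R]_l -> A) : carrier N p ->
  smooth_into N phi -> induced_metric N (fun x => p *m phi x) = induced_metric N phi.
Proof.
by move=> Np hphi; apply/funext => x; rewrite /induced_metric omega_mulmx.
Qed.

Lemma isometry_mulmx p : carrier N p -> Defs.isometry N (mulmx p).
Proof.
have si q : carrier N q -> smooth_isometric N (mulmx q).
  move=> Nq l phi hphi; split; first exact: smooth_into_mulmx.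
  exact: induced_metric_mulmx.
move=> Np; split; first exact: si.
exists (mulmx (invmx p)); first by apply: si; apply: carrierV.
by move=> q Nq; rewrite carrierK ?carrierVK.
Qed.

Lemma cosets_congruent L L' : left_cosets N S L -> left_cosets N S L' -> congruent N L L'.
Proof.
move=> [p Np ->] [p' Np' ->]; exists (mulmx (p' *m invmx p)).
  by apply: isometry_mulmx; apply: carrierM => //; apply: carrierV.
apply/seteqP; split=> [_ [_ [q Sq <-] <-]|_ [q Sq <-]].
  by exists q; rewrite // -mulmxA carrierK.
by exists (p *m q); [exists q|rewrite -mulmxA carrierK].
Qed.

(** Left translations by [S] have the right cosets as orbits; normality identifies them with the
    left ones. *)
Lemma cosets_homogeneous : homogeneous N (left_cosets N S).
Proof.
pose G := [set f : A -> A | exists2 q, S q & f = mulmx q].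
have orbE p : carrier N p -> orbit_of G p = coset p S.
  move=> Np; apply/seteqP; split=> [_ [_ [q Sq ->] <-]|_ [q Sq <-]].
    apply/cosetP => //; rewrite mulmxA.
    have := subgroup_normal sv vvs vnil SN' SM S0S (p := invmx p) (q := q).
    rewrite invmxK -hcar; apply => //; exact: carrierV.
  exists (mulmx (p *m q *m invmx p)).
    exists (p *m q *m invmx p) => //.
    by apply: (subgroup_normal sv vvs vnil SN' SM S0S); rewrite -?hcar.
  by rewrite /= mulmxKV// carrier_unit.
exists G; first split.
- by move=> _ [q Sq ->]; apply/isometry_mulmx/SN.
- by exists 1%:M => //; apply/funext => x; rewrite mul1mx.
- move=> _ _ [q Sq ->] [q' Sq' ->]; exists (q *m q'); first exact: SM.
  by apply/funext => x /=; rewrite mulmxA.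
- move=> _ [q Sq ->]; exists (mulmx (invmx q)).
    by exists (invmx q) => //; apply: SV.
  by move=> p Np; rewrite carrierK ?carrierVK//; apply: SN.
move=> L; by split=> -[p Np ->]; exists p; rewrite ?orbE.
Qed.

Lemma cosets_connected : S = S0 ->
  forall L, left_cosets N S L -> smoothly_connected N L.
Proof.
move=> SE _ [p0 Np0 ->] p q p0p p0q.
have Np := coset_sub Np0 p0p.
have : coset p S q by rewrite -(coset_eq Np0 p0p).
move=> [x Sx <-]; move: (Sx); rewrite {1}SE => /(connected_subgroupP ss snil)[P sP xE].
have gP (t : 'rV[R]_1) : S0 (ex (t 0 0 *: P)).
  by apply/(connected_subgroupP ss snil); exists (t 0 0 *: P); rewrite ?memvZ.
exists (fun t : 'rV[R]_1 => p *m ex (t 0 0 *: P)); split.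
- apply: smooth_into_mulmx => //; split; last by move=> t; apply/SN/S0S.
  apply: smooth_horner.
  have lf : linear (fun t : 'rV[R]_1 => t 0 0 *: P).
    by move=> c t t'; rewrite !mxE scalerDl scalerA.
  pose f : {linear _ -> _} := HB.pack (fun t : 'rV[R]_1 => t 0 0 *: P)
    (GRing.isLinear.Build R 'rV[R]_1 A *:%R _ lf).
  exact: (smooth_linear f).
- by move=> t; rewrite (coset_eq Np0 p0p); exists (ex (t 0 0 *: P)) => //; apply: S0S.
- by rewrite mxE scale0r nexp0 mulmx1.
- by rewrite mxE scale1r xE.
Qed.

(** As the class of log(phi) modulo [s] is constant, phi(x)^-1 phi(y) has its logarithm in [s] for
    every y, and this can be differentiated at y = x. *)
Lemma omega_mem l (phi : 'rV[R]_l -> A) : smooth phi -> (forall x, S (phi x)) ->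
  forall x u, invmx (phi x) *m 'D_u phi x \in s.
Proof.
move=> sphi Sphi x u; have [_ _ _ _ [c Sc]] := hS.
have Nphi y : connected_subgroup v (phi y) by apply: SN'.
apply: (log_derivative_mem (k := k)).
- exact: smooth_derivable.
- by apply: mulVmx; apply: carrier_unit; apply: SN.
- move=> y; have h1 := nlogVM vv vnil sv vvs (Nphi x) (Nphi y).
  have h2 := nlog_constant_class sv vvs vnil SN' SM SV S0S Sc (smooth_continuous sphi) Sphi x y.
  by have := memvD h1 h2; rewrite subrK.
Qed.

Section Chart.
Variable phi : 'rV[R]_m -> A.
Hypothesis iphi : immersion N phi.
Hypothesis Sphi : forall x, S (phi x).
Variable x : 'rV[R]_m.

Lemma omega_s a : omega phi a x \in s.
Proof. by apply: omega_mem; case: iphi => -[]. Qed.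

Lemma sum_omega (c : 'I_m -> R) :
  \sum_a c a *: omega phi a x = invmx (phi x) *m 'D_(\row_a c a) phi x.
Proof.
rewrite derive_sum_partial; last by case: iphi => -[].
by rewrite mulmx_sumr; apply: eq_bigr => a _; rewrite mxE -scalemxAr.
Qed.

Lemma omega_free (c : 'I_m -> R) :
  \sum_a c a *: omega phi a x = 0 -> forall a, c a = 0.
Proof.
move=> c0 a; have [[_ Nphi] inj] := iphi.
have /rowP/(_ a) : \row_a c a = 0; last by rewrite !mxE.
apply: (inj x); rewrite -[LHS](carrierVK _ (Nphi x)) -sum_omega c0.
by rewrite mulmx0.
Qed.

Lemma omega_span w : w \in s -> exists u, w = invmx (phi x) *m 'D_u phi x.
Proof.
move=> sw; have [c ->] := om_span omega_s omega_free (erefl m) sw.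
by exists (\row_a c a); rewrite sum_omega.
Qed.

(** The second fundamental form is the symmetrization of < [nu, .], . >, so its
    trace is that of ad nu on s. *)
Lemma chart_minimal nu : normal N phi x nu -> mean_curvature N phi nu x = 0.
Proof.
move=> [vnu nunu].
have ip_sum (c : 'I_m -> R) : ip N (\sum_a c a *: omega phi a x) nu = 0.
  rewrite (b_sum _ ip_linl); apply: big1 => a _; by rewrite nunu mulr0.
have ip_s w : w \in s -> ip N w nu = 0.
  by move=> /(om_span omega_s omega_free (erefl m))[c ->].
pose T w := nu * w - w * nu.
have ipN w z : ip N (- w) z = - ip N w z.
  have ip0 : ip N 0 z = 0.
    by have := ip_linl (-1) 0 0 z; rewrite scaler0 addr0 mulN1r addNr.
  by have := ip_linl (-1) w 0 z; rewrite addr0 scaleN1r ip0 addr0 mulN1r.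
(* The first term of Koszul's formula pairs nu with a bracket, which lies in [s], and vanishes. *)
have koszulE P Q : P \in v -> Q \in v ->
    koszul N P Q nu = 2^-1 * (ip N (T Q) P + ip N (T P) Q).
  move=> vP vQ; rewrite /koszul; congr (_ * (_ + _)).
  by rewrite (ip_s _ (vvs vP vQ)) sub0r -ipN; congr (ip N _ _); exact: opprB.
have omv a : omega phi a x \in v by apply/svP/omega_s.
have sfE a b : second_form N phi nu a b x =
    2^-1 * (ip N (T (omega phi b x)) (omega phi a x)
            + ip N (T (omega phi a x)) (omega phi b x)).
  (* [omega] takes its values in the closed subspace [s], hence so does its derivative, to which nu
     is orthogonal. *)
  rewrite /second_form ip_s ?add0r; last first.
    apply: derive_mem.
      apply: smooth_derivable; apply: smooth_mulmx.
        by apply: smooth_invmx; case: iphi.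
      by case: iphi => -[/smoothP[_ _ D] _] _; apply: D.
    by move=> y; apply: omega_mem; case: iphi => -[].
  exact: koszulE.
have gE : induced_metric N phi x = gram (ip N) (fun a => omega phi a x).
  by apply/matrixP => i j; rewrite !mxE.
have tr0 : \sum_a \sum_b invmx (induced_metric N phi x) a b *
    ip N (T (omega phi a x)) (omega phi b x) = 0.
  rewrite gE; apply: (trace_form_nilpotent (K := k.+2) (s := s)) => //.
  - by move=> w sw; apply: ip_pos; apply: svP.
  - by move=> c w w'; rewrite /T mulrDr mulrDl opprD addrACA -scalerAr -scalerAl scalerBr.
  - by move=> w /svP vw; apply: vvs.
  - move=> w /svP vw; exact: (iter_ad_eq0 vnil).
  - exact: omega_s.
  - exact: omega_free.
have gT : (invmx (induced_metric N phi x))^T = invmx (induced_metric N phi x).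
  rewrite trmx_inv; congr invmx; apply/matrixP => i j; rewrite !mxE; exact: ipC.
rewrite -[RHS](sum_symmetrize gT tr0).
by apply: eq_bigr => a _; apply: eq_bigr => b _; rewrite sfE.
Qed.

End Chart.


(** The atlases of a foliation are indexed by the leaves as sets, so a base point has to be chosen
    in each coset; 1 is a default for sets that are not cosets. *)
Definition coset_rep (L : set A) : A :=
  if pselect (exists2 p, carrier N p & L = coset p S) is left h then s2val (cid2 h)
  else 1%:M.

Lemma coset_repP L : left_cosets N S L ->
  carrier N (coset_rep L) /\ L = coset (coset_rep L) S.
Proof.
by rewrite /coset_rep; case: pselect => // h _; case: (cid2 h).
Qed.

Lemma immersion_mulmx l p (phi : 'rV[R]_l -> A) : carrier N p ->
  immersion N phi -> immersion N (fun x => p *m phi x).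
Proof.
move=> Np [hphi inj]; split; first exact: smooth_into_mulmx.
move=> x u; rewrite derive_mulmxl; last by apply: smooth_derivable; case: hphi.
move=> /(congr1 (mulmx (invmx p))); rewrite carrierK// mulmx0; exact: inj.
Qed.

Lemma atlas_mulmx l p (phi : nat -> 'rV[R]_l -> A) : carrier N p ->
  atlas N S phi -> atlas N (coset p S) (fun i x => p *m phi i x).
Proof.
move=> Np [hphi SE ov]; split.
- move=> i; have [im inj] := hphi i; split; first exact: immersion_mulmx.
  by move=> x y /(congr1 (mulmx (invmx p))); rewrite !carrierK// => /inj.
- rewrite {1}SE; apply/seteqP; split=> [_ [_ [i _ [x _ <-]] <-]|_ [i _ [x _ <-]]].
    by exists i => //; exists x.
  by exists (phi i x) => //; exists i => //; exists x.
- move=> i j x y V /(congr1 (mulmx (invmx p))); rewrite !carrierK// => e hV.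
  apply: filterS (ov i j x y V e hV) => x' [z Vz ez].
  by exists z => //; rewrite ez.
Qed.

(** * Translating an atlas of [S] to all cosets *)

Section Translates.
Variable phi : nat -> 'rV[R]_m -> A.
Hypothesis hphi : atlas N S phi.

Definition translate (L : set A) i x : A := coset_rep L *m phi i x.

Let Sphi i x : S (phi i x).
Proof. by case: hphi => _ -> _; exists i => //; exists x. Qed.

Let iphi i : immersion N (phi i).
Proof. by case: hphi => h _ _; case: (h i). Qed.

Let sphi i : smooth_into N (phi i).
Proof. by case: (iphi i). Qed.

Let dphi i x u : derivable (phi i) x u.
Proof. by apply: smooth_derivable; case: (sphi i). Qed.

Lemma translate_foliation : foliation N (left_cosets N S) translate.
Proof.
split.
- by move=> p Np; exists (coset p S); [exists p|exists 1%:M; rewrite // mulmx1].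
- move=> _ _ [p Np ->] [q Nq ->] [z [pz qz]].
  by rewrite (coset_eq Np pz) (coset_eq Nq qz).
- move=> L FL; have [Np e] := coset_repP FL; rewrite {1}e; exact: atlas_mulmx.
move=> L p w FL [i [x [u [xp uw]]]]; have [Nr _] := coset_repP FL.
pose w0 := invmx (phi i x) *m 'D_u (phi i) x.
have sw0 : w0 \in s by apply: omega_mem => //; case: (sphi i).
(* The left invariant field of an element of [s] is tangent to every left coset. *)
exists (fun q => q *m w0); split.
- split=> [q Nq|l psi [spsi _]]; first by rewrite carrierK//; apply: svP.
  by apply: smooth_mulmx => //; exact: smooth_cst.
- rewrite -xp -uw /translate derive_mulmxl// /w0 -mulmxA.
  by rewrite carrierVK//; apply: SN.
move=> L' q FL' L'q; have [Nr' e'] := coset_repP FL'.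
move: L'q; rewrite {1}e' => -[q0 Sq0 q0q].
have : (\bigcup_i range (phi i)) q0 by case: hphi => _ <- _.
move=> [j _ [y _ yq0]]; have [u' e] := omega_span (iphi j) (Sphi j) y sw0.
exists j, y, u'; split; first by rewrite /translate yq0.
rewrite /translate derive_mulmxl// e -q0q -yq0 -mulmxA carrierVK//.
exact: SN.
Qed.

Lemma translate_minimal L : left_cosets N S L -> minimal N (translate L).
Proof.
move=> FL i x nu; have [Nr _] := coset_repP FL.
have e : omega (translate L i) = omega (phi i) by exact: omega_mulmx.
rewrite /normal /mean_curvature /second_form /induced_metric e.
exact: chart_minimal.
Qed.

Lemma translate_soliton L : ricci_soliton N phi -> left_cosets N S L ->
  ricci_soliton N (translate L).
Proof.
move=> [c [V hV]] FL; have [Nr _] := coset_repP FL.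
(* The soliton field is pushed forward by the translation; its expression in a chart does not
   change. *)
exists c, (fun q => coset_rep L *m V (invmx (coset_rep L) *m q)) => i.
have [X sX XP] := hV i; exists X; [exact: sX|move=> x].
have [DX ric] := XP x; split.
  by rewrite /translate derive_mulmxl// DX (carrierK (phi i x) Nr).
have e : induced_metric N (translate L i) = induced_metric N (phi i).
  exact: induced_metric_mulmx.
by rewrite e; exact: ric.
Qed.

End Translates.

(** A translate of exp is a global chart of a whole component, so countably many charts suffice. *)
Lemma subgroup_atlas : exists phi : nat -> 'rV[R]_m -> A, atlas N S phi.
Proof.
have [_ _ _ _ [c Sc]] := hS.
(* Indices whose representative is outside [S] repeat the identity component. *)
pose c' i := if pselect (S (c i)) then c i else 1%:M.
have Sc' i : S (c' i) by rewrite /c'; case: pselect.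
have Nc' i : carrier N (c' i) by exact: SN.
have [lin [crd [lin_s linK crdK]]] := vspace_coordinates s.
have nils P : P \in s -> P ^+ k.+2 = 0 by exact: (nil_v snil).
have lgl x : lg (ex (lin x)) = lin x by apply: nlogK; apply: nils.
have S0l x : S0 (ex (lin x)) by apply/(connected_subgroupP ss snil); exists (lin x).
have S0P q : S0 q -> q = ex (lin (crd (lg q))).
  by move=> /(connected_subgroupP ss snil)[P sP ->]; rewrite nlogK ?crdK// nils.
have sl : smooth (fun x => ex (lin x)) by apply/smooth_horner/smooth_linear.
have hl i : smooth_into N (fun x => c' i *m ex (lin x)).
  apply: smooth_into_mulmx => //; split=> // x; exact/SN/S0S.
exists (fun i x => c' i *m ex (lin x)); split.
- move=> i; split; last first.
    by move=> x y /(congr1 (mulmx (invmx (c' i)))); rewrite !carrierK//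
      => /(congr1 lg); rewrite !lgl => /(congr1 crd); rewrite !linK.
  split=> // x u; rewrite derive_mulmxl; last exact: smooth_derivable.
  move=> /(congr1 (mulmx (invmx (c' i)))); rewrite carrierK// mulmx0 => ex0.
  have s1 : smooth (fun x => ex (lin x) + (- 1)) by apply: smoothD; [|exact: smooth_cst].
  have d1 : 'D_u (fun x => ex (lin x) + (- 1)) x = 0.
    have -> : 'D_u (fun x => ex (lin x) + (- 1)) x =
       'D_u (fun x => ex (lin x)) x + 'D_u (fun _ => - 1 : A) x.
      by apply: deriveD; [exact: smooth_derivable|exact: derivable_cst].
    by rewrite ex0 derive_cst addr0.
  have := derive_horner_eq0 (log_poly R k.+2) s1 d1.
  have -> : (fun y => horner_alg (ex (lin y) + (- 1)) (log_poly R k.+2)) = lin.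
    by apply/funext => y; exact: lgl.
  have cl : continuous lin by exact: linear_mx_continuous.
  rewrite deriveE ?diff_lin//; last exact: linear_differentiable.
  by move=> /(congr1 crd); rewrite linK linear0.
- apply/seteqP; split=> [q Sq|_ [i _ [x _ <-]]]; last by apply: SM => //; apply: S0S.
  have [i _ cq] := Sc _ Sq; have Sci := component_rep sv vvs vnil SN' SM SV S0S Sq cq.
  have [q0 S0q0 <-] := cq; exists i => //; exists (crd (lg q0)) => //=.
  by rewrite -S0P// /c'; case: pselect.
move=> i j x y V e hV.
(* Charts that meet parametrize the same component: [q] lies in [S0], so the change of charts is the
   continuous map [F] below, defined on all of R^m. *)
pose q := invmx (c' j) *m c' i.
have qe : q *m ex (lin x) = ex (lin y).
  by rewrite /q -mulmxA e carrierK.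
have S0q : S0 q.
  have -> : q = ex (lin y) *m invmx (ex (lin x)).
    by rewrite -qe mulmxK//; apply/carrier_unit/SN/S0S.
  by apply: (connected_subgroupM ss snil) => //; apply: (connected_subgroupV ss snil).
pose F (x' : 'rV[R]_m) := crd (lg (q *m ex (lin x'))).
have cF : {for x, continuous F}.
  apply: (continuous_comp (f := fun x' => lg (q *m ex (lin x'))) (g := crd)); last first.
    exact: linear_mx_continuous.
  apply: (continuous_comp (f := fun x' => q *m ex (lin x')) (g := lg)); last first.
    exact: nlog_continuous.
  by apply: smooth_continuous; apply: smooth_mulmxl.
have Fx : F x = y by rewrite /F qe lgl linK.
have nV : \forall x' \near x, V (F x') by apply: cF; rewrite Fx.
near=> x'; exists (F x'); first by near: x'.
rewrite /F -S0P; last by apply: (connected_subgroupM ss snil).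
by rewrite mulmxA /q carrierVK.
Unshelve. all: by end_near. Qed.

End Hypersurface.

(** * The inner product of the Iwasawa group *)

Section IwasawaInnerProduct.
Variables (R : realType) (n : nat) (g : lie_algebra R n.+1) (theta : 'M[R]_n.+1).
Variables (nn : {vspace 'cV[R]_n.+1}) (r : R).
Hypotheses (hth : cartan_involution g theta) (r0 : 0 < r).
Notation N := (iwasawa_group g theta nn r).

Lemma iwasawa_ip_linl c x y z : ip N (c *: x + y) z = c * ip N x z + ip N y z.
Proof.
by rewrite /= linearP Btheta_linl !mulrDr; congr (_ + _); rewrite !(mulrCA _ c).
Qed.

Lemma iwasawa_ipC x y : ip N x y = ip N y x.
Proof. by rewrite /= (BthetaC hth). Qed.

Lemma iwasawa_ip_pos x : x \in lie N -> x != 0 -> 0 < ip N x x.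
Proof.
move=> xN x0; have [_ _ pos] := hth; rewrite /= !mulr_gt0 ?invr_gt0 ?ltr0n//.
apply: pos; apply: contraNneq x0 => e.
(* On the image of [ad] its partial inverse is a section, so a zero preimage forces x = 0. *)
have /limg_lfunVK <- : x \in limg (linfun (ad g)) by apply: subvP (limgS _ (subvf _)) _ xN.
by rewrite e linear0.
Qed.

End IwasawaInnerProduct.

Theorem corollary1p6 (R : realType) (d : nat) (g : lie_algebra R d)
  (theta : 'M[R]_d) (hM : irreducible_noncompact_type g theta)
  (a : {vspace 'cV[R]_d}) (ha : maximal_abelian g theta a)
  (Sigma_pos : set ('cV[R]_d -> R)) (hSigma : positive_roots g a Sigma_pos)
  (n : {vspace 'cV[R]_d}) (hn : sum_of_root_spaces g a Sigma_pos n)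
  (r : R) (hr : 0 < r)
  (N : metric_group R d) (hN : N = iwasawa_group g theta n r)
  (S : set 'M[R]_d) (s : {vspace 'M[R]_d}) (hS : lie_subgroup N S s)
  (hcodim : \dim (lie N) = (\dim s).+1) :
  [/\ exists A : set 'M[R]_d -> nat -> 'rV[R]_(\dim s) -> 'M[R]_d,
        foliation N (left_cosets N S) A /\
        (forall L, left_cosets N S L -> minimal N (A L)),
      (S = connected_subgroup s ->
         forall L, left_cosets N S L -> smoothly_connected N L),
      homogeneous N (left_cosets N S),
      (forall L L', left_cosets N S L -> left_cosets N S L' ->
         congruent N L L')
    & forall phi : nat -> 'rV[R]_(\dim s) -> 'M[R]_d,
        atlas N S phi -> ricci_soliton N phi ->
        exists A : set 'M[R]_d -> nat -> 'rV[R]_(\dim s) -> 'M[R]_d,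
          foliation N (left_cosets N S) A /\
          (forall L, left_cosets N S L ->
             minimal N (A L) /\ ricci_soliton N (A L))].
Proof.
destruct d as [|d].
  (* In size 0 the Lie algebra is zero and has no subspace of codimension one. *)
  by have := dimvS (subvf (lie N)); rewrite dimvf /dim /= hcodim.
have [hth _ _ _] := hM; have [K nilK] := lie_n_nil hSigma hn.
have hcar : carrier N = connected_subgroup (lie N) by rewrite hN.
(* The nilpotency bound is raised to K + 2 so that the truncated logarithm keeps its linear term. *)
have vnil (l : seq 'M[R]_d.+1) : (forall P, P \in l -> P \in lie N) ->
    (K.+2 <= size l)%N -> \prod_(P <- l) P = 0.
  by rewrite hN => lN Kl; apply: nilK => //; apply: leq_trans Kl; rewrite -addn2 leq_addr.
have vv P Q : P \in lie N -> Q \in lie N -> P * Q - Q * P \in lie N.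
  rewrite hN; exact: (lie_n_commutator hSigma hn).
have [[sv ss] _ _ _ _] := hS.
have vvs P Q : P \in lie N -> Q \in lie N -> P * Q - Q * P \in s.
  exact: (codim1_commutator vnil vv ss sv hcodim).
have ipl : forall c x y z, ip N (c *: x + y) z = c * ip N x z + ip N y z.
  by rewrite hN; exact: iwasawa_ip_linl.
have ipC : forall x y, ip N x y = ip N y x.
  by rewrite hN; exact: iwasawa_ipC.
have ip_pos : forall x, x \in lie N -> x != 0 -> 0 < ip N x x.
  by rewrite hN; exact: iwasawa_ip_pos.
split.
- have [phi hphi] := subgroup_atlas hcar vvs vnil hS.
  exists (translate N S phi); split.
    exact: (translate_foliation hcar vvs vnil hS hphi).
  exact: (translate_minimal hcar ipl ipC ip_pos vvs vnil hS hphi).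
- exact: (cosets_connected hcar vvs vnil hS).
- exact: (cosets_homogeneous hcar vvs vnil hS).
- exact: (cosets_congruent hcar vvs vnil hS).
- move=> phi hphi sol; exists (translate N S phi); split.
    exact: (translate_foliation hcar vvs vnil hS hphi).
  move=> L FL; split.
    exact: (translate_minimal hcar ipl ipC ip_pos vvs vnil hS hphi).
  exact: (translate_soliton hcar vvs vnil hS hphi sol FL).
Qed.
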